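(* Let $K$ be a field and let $I\subset S=K[x_1,\ldots,x_n]$ be a matroidal ideal with $\operatorname{supp}(I)=\{1,\ldots,n\}$. Then all squarefree powers of $I$ have minimum depth, i.e. $g_I(k)=0$ for all $k=1,\ldots,\nu(I)$.
   Context: For a monomial ideal $I$, $G(I)$ denotes its unique minimal set of monomial generators; $\operatorname{supp}(u)=\{i : x_i\mid u\}$ for a monomial $u$, and $\operatorname{supp}(I)=\bigcup_{u\in G(I)}\operatorname{supp}(u)$. A monomial ideal $I$ is polymatroidal if it is generated in a single degree and for all $u,v\in G(I)$ and every $i$ with $\deg_{x_i}(u)>\deg_{x_i}(v)$ there is $j$ with $\deg_{x_j}(u)<\deg_{x_j}(v)$ and $x_j(u/x_i)\in G(I)$. A matroidal ideal is a polymatroidal ideal generated by squarefree monomials. For $k\ge 1$, the $k$-th squarefree power $I^{[k]}$ of a squarefree monomial ideal $I$ is the ideal generated by all products $u_1\cdots u_k$ with $u_1,\ldots,u_k\in G(I)$ that are squarefree monomials. $\nu(I)$ is the maximum length of a regular sequence of monomials contained in $I$. For $1\le k\le \nu(I)$ put $d_k=\min\{\deg u : u\in G(I^{[k]})\}$ and $g_I(k)=\operatorname{depth}(S/I^{[k]})-(d_k-1)$. *)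

(* Defs.v *)
From Stdlib Require Import ClassicalEpsilon.
From HB Require Import structures.
From mathcomp Require Import all_boot all_order all_algebra.
From mathcomp Require Import mpoly.

Set Implicit Arguments.
Unset Strict Implicit.
Unset Printing Implicit Defensive.

Import GRing.Theory.
Local Open Scope ring_scope.

Definition is_max (P : nat -> Prop) (m : nat) : Prop :=
  P m /\ forall r, P r -> (r <= m)%N.

Definition is_min (P : nat -> Prop) (m : nat) : Prop :=
  P m /\ forall r, P r -> (m <= r)%N.

(* These are unspecified when the maximum (minimum) does not exist. *)
Definition nat_max (P : nat -> Prop) : nat := epsilon (inhabits 0%N) (is_max P).
Definition nat_min (P : nat -> Prop) : nat := epsilon (inhabits 0%N) (is_min P).

Lemma nat_maxP (P : nat -> Prop) (m : nat) : is_max P m -> nat_max P = m.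
Proof.
move=> Pm; have [P0 le0] := epsilon_spec (inhabits 0%N) (is_max P) (ex_intro _ m Pm).
by case: Pm => Pm lem; apply/eqP; rewrite eqn_leq lem // le0.
Qed.

Lemma nat_minP (P : nat -> Prop) (m : nat) : is_min P m -> nat_min P = m.
Proof.
move=> Pm; have [P0 le0] := epsilon_spec (inhabits 0%N) (is_min P) (ex_intro _ m Pm).
by case: Pm => Pm lem; apply/eqP; rewrite eqn_leq lem // le0.
Qed.

Section Ideals.
Variables (n : nat) (K : fieldType).
Local Notation S := {mpoly K[n]}.
Implicit Types (I J : S -> Prop) (A B : 'X_{1..n} -> Prop) (u v w : 'X_{1..n}).

Definition ideal_gen (X : S -> Prop) (f : S) : Prop :=
  exists2 s : seq (S * S), forall p, p \in s -> X p.2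
                         & f = \sum_(p <- s) p.1 * p.2.

Definition zero_ideal (f : S) : Prop := f = 0.

(* The graded maximal ideal (x_1, ..., x_n). *)
Definition max_ideal : S -> Prop := ideal_gen (fun f => exists i : 'I_n, f = 'X_i).

(* The monomials of S are represented by their exponent vectors. *)
Definition monomial_gen A : S -> Prop :=
  ideal_gen (fun f => exists2 u, A u & f = 'X_[u]).

Definition generates A I : Prop := forall f, I f <-> monomial_gen A f.

Definition monomial_ideal I : Prop := exists A, generates A I.

Definition min_generates A I : Prop :=
  generates A I /\
  forall B, (forall u, B u -> A u) -> generates B I -> forall u, A u -> B u.

(* u \in G(I): the minimal set of monomial generators exists and is unique
   for every monomial ideal I. *)
Definition mingens I u : Prop := exists2 A, min_generates A I & A u.

Definition supp_mon u : {set 'I_n} := [set i | (0 < u i)%N].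

Definition supp_ideal I (i : 'I_n) : Prop :=
  exists2 u, mingens I u & i \in supp_mon u.

Definition polymatroidal I : Prop :=
  [/\ monomial_ideal I,
      exists d, forall u, mingens I u -> mdeg u = d
    & forall u v, mingens I u -> mingens I v ->
      forall i, (v i < u i)%N ->
      exists2 j, (u j < v j)%N & mingens I (U_(j) + (u - U_(i)))%MM].

Definition squarefree_mon u : Prop := forall i, (u i <= 1)%N.

Definition matroidal I : Prop :=
  polymatroidal I /\ forall u, mingens I u -> squarefree_mon u.

Definition squarefree_power I (k : nat) : S -> Prop :=
  monomial_gen (fun w =>
    squarefree_mon w /\
    exists2 t : k.-tuple 'X_{1..n}, forall u, u \in t -> mingens I u
                                  & w = (\sum_(u <- t) u)%MM).

(* J + (f : f \in s) *)
Definition ideal_adjoin J (s : seq S) : S -> Prop :=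
  ideal_gen (fun f => J f \/ f \in s).

(* s is a regular sequence on the module S/J.  For M = S/J, the quotient
   M/(f_1, ..., f_i)M is S/(J + (f_1, ..., f_i)). *)
Definition regular_seq J (s : seq S) : Prop :=
  (forall i, (i < size s)%N ->
     forall g, ideal_adjoin J (take i s) (s`_i * g) ->
               ideal_adjoin J (take i s) g)
  /\ ~ ideal_adjoin J s 1.

(* depth(S/J) *)
Definition depth_quot J : nat :=
  nat_max (fun r => exists s : seq S,
    [/\ size s = r, forall f, f \in s -> max_ideal f & regular_seq J s]).

Definition nu I : nat :=
  nat_max (fun r => exists s : seq 'X_{1..n},
    [/\ size s = r, forall u, u \in s -> I 'X_[u]
      & regular_seq zero_ideal [seq 'X_[u] | u <- s]]).

Definition min_degree I (k : nat) : nat :=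
  nat_min (fun d => exists2 u, mingens (squarefree_power I k) u & mdeg u = d).

Definition normalized_depth I (k : nat) : int :=
  (depth_quot (squarefree_power I k))%:Z - ((min_degree I k)%:Z - 1).

End Ideals.

(* Main.v *)
From Stdlib Require Import Classical FunctionalExtensionality PropExtensionality.
Require Import Defs.
From mathcomp Require Import all_boot all_order all_algebra.
From mathcomp Require Import mpoly.
From mathcomp Require Import ring zify.

(** Write [S] for the polynomial ring, [d] for the degree of the generators of
    [I], and put [D = k d]. The ideal [J = I^[k]] is generated by squarefree
    monomials of degree [D], the products of [k] generators of [I] with
    disjoint supports; one exists since [k <= nu(I)]. So [d_k = D], and the
    claim is that [S/J] has depth [D - 1].

    Lower bound. For every ideal [J] generated by squarefree monomials of
    degree at least [D], in at least [D - 1] variables, the depth of [S/J] is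
    at least [D - 1]. The field may be finite, so general linear forms are not
    available. Instead one sequence that works for all such [J] is built by
    induction on the number of variables: given [a_1, ..., a_r] and a new
    variable [x], put [f_j = x f_1 ... f_(j-1) + a_j]. Each [f_j] is congruent to
    [a_j] modulo [x] and modulo every earlier [f_l], and is monic in [x].
    Modulo [J + (x)] the [f_j] act as the [a_j]. Modulo [J : x], an ideal
    generated by monomials without [x] whose degree has dropped by at most
    one, [f_1] is regular because it is monic, and the others then act as
    [a_2, ..., a_r], one element fewer. The exact sequence
    [0 -> S/(J : x) -> S/J -> S/(J + (x)) -> 0] combines the two
    ([universally_regular_lift]).

    Upper bound. The supports of the generators of [J] are the bases of a
    matroid of rank [D], the [k]-fold union of the matroid of [I]
    ([union_matroid_independence]), without loops since [supp(I)] is everything.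
    The successive differences of a complete flag of flats partition the
    variables into [D] parts [P_0, ..., P_(D-1)] all of whose transversals are
    bases ([independent_transversals]). Let [e_P] be the exterior product of the
    [e_i] with [i] in [P]. The product of the Koszul boundaries of the [e_(P_l)]
    has coefficients in [J]; it is the boundary of a chain of exterior degree
    [n - D + 1], in which one factor is replaced by [e_(P_l)] itself. That
    chain is therefore a Koszul cycle modulo [J], and it is not a boundary
    modulo [J], because the product has coefficients of degree exactly [D]
    whereas the boundary of a chain with coefficients in [J] has none. A
    nonzero Koszul class in exterior degree [m] is raised by each element of a
    regular sequence to a nonzero class of exterior degree one higher, and
    exterior degrees are at most [n], so a regular sequence has length at most
    [n - m] ([koszul_cycle_bound]). With [m = n - D + 1] this is [D - 1]
    ([regular_seq_lt_parts]). *)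

Set Implicit Arguments.
Unset Strict Implicit.
Unset Printing Implicit Defensive.

Import GRing.Theory.
Local Open Scope ring_scope.

Lemma pred_ext (T : Type) (P Q : T -> Prop) : (forall x, P x <-> Q x) -> P = Q.
Proof.
by move=> PQ; apply: functional_extensionality => x; apply: propositional_extensionality.
Qed.

(** * Ideals and weakly regular sequences in a commutative ring *)

Section Regular.
Variable R : comNzRingType.
Implicit Types (J : R -> Prop) (a b f g h x : R) (s : seq R).

Definition is_ideal J : Prop :=
  [/\ J 0, forall f g, J f -> J g -> J (f + g) & forall f g, J g -> J (f * g)].

Section IdealTheory.
Variables (J : R -> Prop) (idJ : is_ideal J).

Lemma idl0 : J 0. Proof. by case: idJ. Qed.
Lemma idlD f g : J f -> J g -> J (f + g). Proof. by case: idJ => _ + _; apply. Qed.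
Lemma idlMl f g : J g -> J (f * g). Proof. by case: idJ => _ _; apply. Qed.
Lemma idlMr f g : J g -> J (g * f). Proof. by rewrite mulrC; apply: idlMl. Qed.
Lemma idlN f : J f -> J (- f). Proof. by rewrite -mulN1r; apply: idlMl. Qed.
Lemma idlB f g : J f -> J g -> J (f - g).
Proof. by move=> Jf Jg; apply: idlD => //; apply: idlN. Qed.

Lemma idl_sum (I : Type) (r : seq I) (P : pred I) (F : I -> R) :
  (forall i, P i -> J (F i)) -> J (\sum_(i <- r | P i) F i).
Proof. by move=> JF; apply: (big_ind J) => //; [exact: idl0 | exact: idlD]. Qed.

End IdealTheory.

Definition adjoin J a f : Prop := exists h, J (f - h * a).

Definition colon J a f : Prop := J (a * f).

Definition nonzerodiv J a : Prop := forall g, J (a * g) -> J g.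

(** Regularity on [R/J] without the requirement that the final quotient be
    nonzero; recursion on the head makes the quotient by the first element
    again an instance of the definition. *)
Fixpoint weakly_regular J s : Prop :=
  if s is a :: s' then nonzerodiv J a /\ weakly_regular (adjoin J a) s'
  else True.

Lemma adjoin_ideal J a : is_ideal J -> is_ideal (adjoin J a).
Proof.
move=> idJ; split=> [|f g [h Jf] [k Jg]|f g [h Jg]].
- by exists 0; rewrite mul0r subr0; apply: idl0.
- exists (h + k); have -> : f + g - (h + k) * a = (f - h * a) + (g - k * a) by ring.
  exact: idlD.
- exists (f * h); have -> : f * g - f * h * a = f * (g - h * a) by ring.
  exact: idlMl.
Qed.

Lemma colon_ideal J a : is_ideal J -> is_ideal (colon J a).
Proof.
move=> idJ; split=> [|f g|f g]; rewrite /colon.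
- by rewrite mulr0; apply: idl0.
- by rewrite mulrDr; apply: idlD.
- by rewrite mulrCA; apply: idlMl.
Qed.

Lemma sub_adjoin J a f : is_ideal J -> J f -> adjoin J a f.
Proof. by move=> idJ Jf; exists 0; rewrite mul0r subr0. Qed.

Lemma adjoin_self J a : is_ideal J -> adjoin J a a.
Proof. by move=> idJ; exists 1; rewrite mul1r subrr; apply: idl0. Qed.

Lemma adjoin_comm J a b : adjoin (adjoin J a) b = adjoin (adjoin J b) a.
Proof.
by apply: pred_ext => f; split=> -[h [k]] H; exists k, h; rewrite addrAC.
Qed.

Lemma adjoin_congr J a b : is_ideal J -> J (a - b) -> adjoin J a = adjoin J b.
Proof.
move=> idJ Jab; apply: pred_ext => f; split=> -[h Jf]; exists h.
  have -> : f - h * b = (f - h * a) + h * (a - b) by ring.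
  by apply: idlD => //; apply: idlMl.
have -> : f - h * a = (f - h * b) + - h * (a - b) by ring.
by apply: idlD => //; apply: idlMl.
Qed.

Lemma nonzerodiv_congr J a b :
  is_ideal J -> J (a - b) -> nonzerodiv J a -> nonzerodiv J b.
Proof.
move=> idJ Jab nza g Jbg; apply: nza.
have -> : a * g = (a - b) * g + b * g by ring.
by apply: idlD => //; apply: idlMr.
Qed.

(** The inclusion from left to right is exactness on the left of
    [0 -> R/(J : x) -> R/J -> R/(J + (x)) -> 0] after reduction modulo [a],
    which holds because [a] is regular on the last term. *)
Lemma colon_adjoin J x a : is_ideal J -> nonzerodiv (adjoin J x) a ->
  colon (adjoin J a) x = adjoin (colon J x) a.
Proof.
move=> idJ nza; apply: pred_ext => h; split=> -[g Jg]; last first.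
  exists (x * g); have -> : x * h - x * g * a = x * (h - g * a) by ring.
  exact: Jg.
have [|u Ju] := nza g.
  exists h; have -> : a * g - h * x = - (x * h - g * a) by ring.
  exact: idlN.
exists u; rewrite /colon.
have -> : x * (h - u * a) = (x * h - g * a) + a * (g - u * x) by ring.
by apply: idlD => //; apply: idlMl.
Qed.

(** Regularity passes through the exact sequence
    [0 -> R/(J : x) -> R/J -> R/(J + x) -> 0]. *)
Lemma weakly_regular_extension J x s : is_ideal J ->
  weakly_regular (colon J x) s -> weakly_regular (adjoin J x) s ->
  weakly_regular J s.
Proof.
elim: s J => //= a s IHs J idJ [nzc rc] [nzx rx]; split.
  move=> g Jag; have [|h Jh] := nzx g; first exact: sub_adjoin.
  have -> : g = (g - h * x) + x * h by ring.
  apply: idlD => //; apply: nzc; rewrite /colon.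
  have -> : x * (a * h) = a * g - a * (g - h * x) by ring.
  by apply: idlB => //; apply: idlMl.
apply: IHs; first exact: adjoin_ideal.
  by rewrite colon_adjoin.
by rewrite adjoin_comm.
Qed.

Lemma weakly_regularP J s : weakly_regular J s <->
  forall i, (i < size s)%N -> nonzerodiv (foldl adjoin J (take i s)) s`_i.
Proof.
elim: s J => [|a s IHs] J /=; first by [].
split=> [[nza /IHs reg] [|i] //=|reg]; first exact: reg.
by split; [exact: (reg 0%N) | apply/IHs => i; exact: (reg i.+1)].
Qed.

(** The coefficients of [P] are recovered from those of [F * P], from the top
    one downwards. *)
Lemma monic_coef_mem J (F P : {poly R}) : is_ideal J -> F \is monic ->
  (forall k, J (F * P)`_k) -> forall j, J P`_j.
Proof.
move=> idJ monF JFP j.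
have [m] := ubnP (size P - j)%N; elim: m j => // m IHm j ltm.
have [le_Pj|lt_jP] := leqP (size P) j; first by rewrite nth_default //; apply: idl0.
have := JFP ((size F).-1 + j)%N; rewrite coefM.
have ltN : ((size F).-1 < ((size F).-1 + j).+1)%N by lia.
rewrite (bigD1 (Ordinal ltN)) //= -lead_coefE (monicP monF) mul1r addKn => JN.
rewrite -[P`_j](addrK (\sum_(k < ((size F).-1 + j).+1 | k != Ordinal ltN)
  F`_k * P`_((size F).-1 + j - k))).
apply: idlB => //; apply: idl_sum => // k; rewrite -val_eqE /= => ne_kN.
have [lt_kN|le_Nk] := ltnP k (size F).-1.
  apply: idlMl => //; apply: IHm; move: (nat_of_ord k) lt_kN => l.
  by move: (size P) (size F).-1 ltm lt_jP; clear=> p N; lia.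
rewrite (@nth_default _ _ F) ?mul0r; first exact: idl0.
by move: (nat_of_ord k) ne_kN le_Nk => l; move: (size F); clear; lia.
Qed.

End Regular.

(** * Ideals of polynomials and regular sequences *)

Section MonomialIdeals.
Variables (n : nat) (K : fieldType).
Local Notation S := {mpoly K[n]}.
Implicit Types (I J : S -> Prop) (f g : S) (A B : 'X_{1..n} -> Prop).
Implicit Types (u v w : 'X_{1..n}).

Lemma ideal_gen_ideal (X : S -> Prop) : is_ideal (ideal_gen X).
Proof.
split=> [|_ _ [s Xs ->] [t Xt ->]|f _ [s Xs ->]].
- by exists [::]; [move=> p; rewrite in_nil | rewrite big_nil].
- exists (s ++ t); last by rewrite big_cat.
  by move=> p; rewrite mem_cat => /orP[/Xs|/Xt].
- exists [seq (f * p.1, p.2) | p <- s].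
    by move=> p /mapP[q /Xs Xq ->].
  by rewrite big_map mulr_sumr; apply: eq_bigr => p _; rewrite mulrA.
Qed.

Lemma mem_ideal_gen (X : S -> Prop) f : X f -> ideal_gen X f.
Proof.
move=> Xf; exists [:: (1, f)]; last by rewrite big_seq1 mul1r.
by move=> p; rewrite inE => /eqP->.
Qed.

Lemma ideal_gen_min (X : S -> Prop) J f : is_ideal J ->
  (forall g, X g -> J g) -> ideal_gen X f -> J f.
Proof.
move=> idJ XJ [s Xs ->]; rewrite big_seq_cond; apply: idl_sum => // p.
by rewrite andbT => /Xs/XJ Jp; apply: idlMl.
Qed.

Lemma ideal_adjoinE J (s : seq S) :
  is_ideal J -> ideal_adjoin J s = foldl (@adjoin _) J s.
Proof.
elim: s J => [|a s IHs] J idJ /=.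
  apply: pred_ext => f; split; last by move=> Jf; apply: mem_ideal_gen; left.
  by apply: ideal_gen_min => // g [].
rewrite -IHs; last exact: adjoin_ideal.
apply: pred_ext => f; split; apply: ideal_gen_min; try exact: ideal_gen_ideal.
  move=> g [Jg|]; first by apply: mem_ideal_gen; left; apply: sub_adjoin.
  rewrite inE => /orP[/eqP->|gs]; apply: mem_ideal_gen; last by right.
  by left; apply: adjoin_self.
move=> g [[h Jh]|gs]; last by apply: mem_ideal_gen; right; rewrite inE gs orbT.
rewrite -[g](subrK (h * a)); apply: (idlD (ideal_gen_ideal _)).
  by apply: mem_ideal_gen; left.
by apply/(idlMl (ideal_gen_ideal _))/mem_ideal_gen; right; rewrite inE eqxx.
Qed.

Lemma max_ideal_coeff0 (f : S) : max_ideal f -> f@_0%MM = 0.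
Proof.
apply: (@ideal_gen_min _ (fun f => f@_0%MM = 0)).
  split=> [|g h g0 h0|g h h0]; first by rewrite mcoeff0.
    by rewrite mcoeffD g0 h0 addr0.
  by rewrite (rmorphM (mcoeff 0%MM)) /= h0 mulr0.
by move=> _ [i ->]; rewrite mcoeffX mnm1_eq0.
Qed.

Lemma max_ideal_ideal : is_ideal (@max_ideal n K).
Proof. exact: ideal_gen_ideal. Qed.

Lemma max_idealX i : @max_ideal n K 'X_i.
Proof. by apply: mem_ideal_gen; exists i. Qed.

(** Inside the maximal ideal the quotients are automatically nonzero. *)
Lemma regular_seqP J (s : seq S) : is_ideal J ->
  (forall f, J f -> max_ideal f) -> (forall f, f \in s -> max_ideal f) ->
  regular_seq J s <-> weakly_regular J s.
Proof.
move=> idJ Jm sm; rewrite weakly_regularP; split=> [[reg _] i lt_is g|reg].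
  by have := reg i lt_is g; rewrite ideal_adjoinE.
split=> [i lt_is g|]; first by rewrite ideal_adjoinE //; apply: reg.
move=> s1; have/max_ideal_coeff0 : @max_ideal n K 1.
  by apply: (ideal_gen_min max_ideal_ideal _ s1) => g [/Jm|/sm].
by rewrite mcoeff1 eqxx => /eqP; rewrite oner_eq0.
Qed.

(** * Monomial ideals and their minimal generators *)

Lemma mpolyX_divl u v : (u <= v)%MM -> 'X_[v] = 'X_[v - u] * 'X_[u] :> S.
Proof. by move=> le_uv; rewrite -mpolyXD submK. Qed.

Lemma msuppXM (f : S) u w :
  reflect (exists2 v, v \in msupp f & w = (u + v)%MM) (w \in msupp ('X_[u] * f)).
Proof. by rewrite mulrC (perm_mem (msuppMX f u)); apply: mapP. Qed.

Lemma mpolyX_gen A u : A u -> monomial_gen A ('X_[u] : S).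
Proof. by move=> Au; apply: mem_ideal_gen; exists u. Qed.

Lemma monomial_gen_ideal A : is_ideal (@monomial_gen n K A).
Proof. exact: ideal_gen_ideal. Qed.

Lemma msupp_ideal (U : 'X_{1..n} -> Prop) :
  (forall u v, U v -> U (u + v)%MM) ->
  is_ideal (fun f : S => forall w, w \in msupp f -> U w).
Proof.
move=> up; split=> [w|f g fU gU w|f g gU w]; first by rewrite msupp0.
  by move/msuppD_le; rewrite mem_cat => /orP[/fU|/gU].
by move/msuppM_le/allpairsP=> [[u v] /= [_ vg ->]]; apply/up/gU.
Qed.

Lemma monomial_genP A f :
  monomial_gen A f <-> forall w, w \in msupp f -> exists2 u, A u & (u <= w)%MM.
Proof.
split=> [|fA].
  apply: (@ideal_gen_min _ (fun f : S => forall w, w \in msupp f ->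
      exists2 u, A u & (u <= w)%MM)).
    apply: msupp_ideal => u v [m Am le_mv]; exists m => //.
    exact: lepm_trans le_mv (lem_addl _ _).
  by move=> _ [u Au ->] w; rewrite msuppX inE => /eqP->; exists u; rewrite ?lepm_refl.
rewrite [f]mpolyE big_seq_cond; apply: idl_sum => [|w].
  exact: monomial_gen_ideal.
rewrite andbT => /fA[u Au le_uw]; rewrite (mpolyX_divl le_uw) scalerAl.
exact/(idlMl (monomial_gen_ideal A))/mpolyX_gen.
Qed.

Lemma monomial_genX A w :
  monomial_gen A ('X_[w] : S) <-> exists2 u, A u & (u <= w)%MM.
Proof.
rewrite monomial_genP; split; first by apply; rewrite msuppX mem_head.
by move=> wA v; rewrite msuppX inE => /eqP->.
Qed.

Lemma monomial_gen_sub A B f : (forall u, A u -> B u) ->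
  monomial_gen A f -> monomial_gen B f.
Proof.
move=> AB; apply: ideal_gen_min; first exact: monomial_gen_ideal.
by move=> _ [u Au ->]; apply/mpolyX_gen/AB.
Qed.

Lemma mnm_neq0 u : u <> 0%MM -> exists i, u i <> 0%N.
Proof.
move=> u_neq0; apply: NNPP => nz; apply: u_neq0; apply/mnmP => i.
by rewrite mnm0E; apply: NNPP => ui; apply: nz; exists i.
Qed.

Lemma lem_anti u v : (u <= v)%MM -> (v <= u)%MM -> u = v.
Proof.
move=> /mnm_lepP uv /mnm_lepP vu; apply/mnmP => i.
by apply/eqP; rewrite eqn_leq uv vu.
Qed.

Lemma lem_mdeg u v : (u <= v)%MM -> (mdeg u <= mdeg v)%N.
Proof. by move/mnm_lepP => uv; rewrite !mdegE leq_sum. Qed.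

Lemma lem_mdeg_eq u v : (u <= v)%MM -> mdeg u = mdeg v -> u = v.
Proof.
move=> uv eq_uv; have := congr1 mdeg (submK uv).
rewrite mdegD eq_uv -[RHS]add0n => /addIn/eqP; rewrite mdeg_eq0 => /eqP vu0.
by rewrite -(submK uv) vu0 add0m.
Qed.

Definition minimal_monomial I u : Prop :=
  I 'X_[u] /\ forall v, I 'X_[v] -> (v <= u)%MM -> v = u.

Lemma minimal_monomial_exists I w :
  I 'X_[w] -> exists2 u, minimal_monomial I u & (u <= w)%MM.
Proof.
have [m] := ubnP (mdeg w); elim: m w => // m IHm w lt_wm Iw.
have [wmin|] := classic (minimal_monomial I w); first by exists w; rewrite ?lepm_refl.
move=> nmin; have [v [Iv le_vw ne_vw]] : exists v, [/\ I 'X_[v], (v <= w)%MM & v <> w].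
  apply: NNPP => nv; apply: nmin; split=> // v Iv le_vw.
  by apply: NNPP => ne_vw; apply: nv; exists v.
have lt_vw : (mdeg v < mdeg w)%N.
  rewrite ltn_neqAle lem_mdeg // andbT; apply/eqP => eq_vw.
  exact/ne_vw/lem_mdeg_eq.
have [u umin le_uv] := IHm v (leq_trans lt_vw lt_wm) Iv.
by exists u => //; apply: lepm_trans le_vw.
Qed.

Lemma generates_minimal I : monomial_ideal I -> generates (minimal_monomial I) I.
Proof.
move=> [A gA] f; split; last first.
  move/(ideal_gen_min _); apply=> [|_ [u [Iu _] ->] //].
  rewrite (_ : I = monomial_gen A); first exact: monomial_gen_ideal.
  exact: pred_ext.
move/gA/monomial_genP => fA; apply/monomial_genP => w /fA[u Au le_uw].
have [|v vmin le_vu] := @minimal_monomial_exists I u; first exact/gA/mpolyX_gen.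
by exists v => //; apply: lepm_trans le_uw.
Qed.

Lemma mingensE I : monomial_ideal I -> mingens I = minimal_monomial I.
Proof.
move=> mI; have gmin := generates_minimal mI.
apply: pred_ext => u; split=> [[A [gA Amin] Au]|umin].
  (* the minimal monomials lie in A, and generate I *)
  apply: (Amin (minimal_monomial I)) => // v [Iv vmin].
  have /monomial_genX[w Aw le_wv] := proj1 (gA _) Iv.
  by rewrite -(vmin w) //; apply/gA/mpolyX_gen.
exists (minimal_monomial I) => //; split=> // B Bmin gB v [Iv vmin].
have /monomial_genX[w Bw le_wv] := proj1 (gB _) Iv.
by rewrite -(vmin w) //; have [] := Bmin w Bw.
Qed.

(** Monomials of one degree do not divide each other. *)
Lemma mingens_equigenerated A d : (forall u, A u -> mdeg u = d) ->
  mingens (@monomial_gen n K A) = A.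
Proof.
move=> degA; rewrite mingensE; last by exists A.
apply: pred_ext => u; split=> [[/monomial_genX[v Av le_vu] umin]|Au].
  by rewrite -(umin v) //; apply: mpolyX_gen.
split=> [|v /monomial_genX[w Aw le_wv] le_vu]; first exact: mpolyX_gen.
have eq_wu : w = u.
  by apply: lem_mdeg_eq; [exact: lepm_trans le_vu | rewrite !degA].
by apply: lem_anti => //; rewrite -eq_wu.
Qed.

End MonomialIdeals.

Arguments monomial_gen_ideal {n K} A.
Arguments mpolyX_gen {n K A u}.
Arguments monomial_genX {n K A w}.

(** * Ideals extended from the other variables *)

Section InOneVariable.
Variables (n : nat) (K : fieldType) (i : 'I_n).
Local Notation S := {mpoly K[n]}.
Implicit Types (J : S -> Prop) (f g a : S) (s : seq S) (u v w : 'X_{1..n}).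

(** The coefficients stay in [S] itself, so that an ideal can be compared with
    the set of coefficients of its elements. The term is locked because
    conversion would otherwise compute with the substitution. *)
Fact in_var_key : unit. Proof. by []. Qed.
Definition in_var : {rmorphism S -> {poly S}} := locked_with in_var_key
  (mmap (polyC \o @mpolyC n K) (fun j => if j == i then 'X else ('X_j)%:P)
     : {rmorphism S -> {poly S}}).

Definition var_free a : Prop := in_var a = a%:P.

(** This holds of the ideals generated by elements without the variable [i],
    which are the only ones it is used for. *)
Definition coef_closed J : Prop := forall f k, J f -> J (in_var f)`_k.

Lemma in_varX j : in_var 'X_j = if j == i then 'X else ('X_j)%:P.
Proof. by rewrite /in_var unlock /= mmapX mmap1U. Qed.

Lemma in_varC (c : K) : in_var c%:MP = (c%:MP)%:P.
Proof. by rewrite /in_var unlock /= mmapC. Qed.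

Lemma horner_in_var f : (in_var f).['X_i] = f.
Proof.
rewrite {1}[f]mpolyE [RHS]mpolyE rmorph_sum horner_sum; apply: eq_bigr => u _.
rewrite -mul_mpolyC rmorphM hornerM in_varC hornerC; congr (_ * _).
rewrite mpolyXE_id rmorph_prod horner_prod; apply: eq_bigr => j _.
rewrite rmorphXn horner_exp in_varX; congr (_ ^+ _).
by case: eqP => [->|_]; rewrite ?hornerX ?hornerC.
Qed.

Lemma coef_closedP J f :
  is_ideal J -> coef_closed J -> J f <-> forall k, J (in_var f)`_k.
Proof.
move=> idJ ccJ; split=> [Jf k|Jf]; first exact: ccJ.
rewrite -(horner_in_var f) horner_coef; apply: idl_sum => // k _.
exact: idlMr.
Qed.

Lemma monic_nonzerodiv J f : is_ideal J -> coef_closed J ->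
  in_var f \is monic -> nonzerodiv J f.
Proof.
move=> idJ ccJ monf g Jfg; apply/coef_closedP => // j.
by apply: (monic_coef_mem idJ monf) => k; rewrite -rmorphM; apply: ccJ.
Qed.

Lemma var_free0 : var_free 0. Proof. by rewrite /var_free !rmorph0. Qed.

Lemma var_freeX j : j != i -> var_free 'X_j.
Proof. by rewrite /var_free in_varX => /negbTE->. Qed.

Lemma var_freeD a b : var_free a -> var_free b -> var_free (a + b).
Proof. by rewrite /var_free !rmorphD /= => -> ->. Qed.

Lemma var_freeM a b : var_free a -> var_free b -> var_free (a * b).
Proof. by rewrite /var_free !rmorphM /= => -> ->. Qed.

Lemma var_free1 : var_free 1. Proof. by rewrite /var_free !rmorph1. Qed.

Lemma var_freeXm u : u i = 0%N -> var_free 'X_[u].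
Proof.
move=> ui0; rewrite mpolyXE_id; apply: big_ind; [exact: var_free1|exact: var_freeM|].
move=> j _; have [->|ne_ji] := eqVneq j i; first by rewrite ui0; apply: var_free1.
elim: (u j) => [|k IHk]; first exact: var_free1.
by rewrite exprS; apply: var_freeM => //; apply: var_freeX.
Qed.

Lemma coef_closed_adjoin J a : is_ideal J -> coef_closed J -> var_free a ->
  coef_closed (adjoin J a).
Proof.
move=> idJ ccJ fra f k [h Jf]; exists (in_var h)`_k.
by have := ccJ _ k Jf; rewrite rmorphB rmorphM fra /= coefB coefMC.
Qed.

Lemma coef_closed_ideal J :
  is_ideal J -> is_ideal (fun f : S => forall k, J (in_var f)`_k).
Proof.
move=> idJ; split=> [k|f g Jf Jg k|f g Jg k].
- by rewrite rmorph0 coef0; apply: idl0.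
- by rewrite rmorphD coefD; exact: (idlD idJ).
- by rewrite rmorphM coefM; apply: (idl_sum idJ) => j _; exact: (idlMl idJ).
Qed.

Lemma coef_closed_monomial_gen A : (forall u, A u -> u i = 0%N) ->
  coef_closed (monomial_gen A).
Proof.
move=> A0 f k; move: f k.
have idJ := coef_closed_ideal (monomial_gen_ideal A).
move=> f k /(ideal_gen_min idJ); apply=> _ [u Au ->] {}k.
rewrite (var_freeXm (A0 u Au)) coefC.
by case: ifP => _; [exact: mpolyX_gen | exact: (idl0 (monomial_gen_ideal A))].
Qed.

End InOneVariable.

Arguments in_var {n K} i.

(** * A sequence regular modulo all ideals generated in large degree *)

Section UniversalSequence.
Variables (n : nat) (K : fieldType).
Local Notation S := {mpoly K[n]}.
Implicit Types (J : S -> Prop) (x q f a : S) (s : seq S).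
Implicit Types (A : 'X_{1..n} -> Prop) (u v w : 'X_{1..n}) (i : 'I_n).

(** A permutation of a regular sequence: [s] followed by [f] is regular because
    [f] is monic and the ideals generated by [J] and elements of [s] come from
    the other variables; [f] may then be moved to the front, as it is regular
    modulo each of these ideals. *)
Lemma weakly_regular_add_monic i J f s : is_ideal J -> coef_closed i J ->
  (forall a, a \in s -> var_free i a) -> in_var i f \is monic ->
  weakly_regular J s -> weakly_regular (adjoin J f) s.
Proof.
elim: s J => //= a s IHs J idJ ccJ frs monf [nza reg].
have fra : var_free i a by apply: frs; rewrite mem_head.
have ccJa := coef_closed_adjoin idJ ccJ fra.
have idJa := adjoin_ideal a idJ.
split; last first.
  rewrite adjoin_comm; apply: IHs => // b bs; apply: frs.
  by rewrite inE bs orbT.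
move=> g [h Jgh].
(* a g = h f modulo J, and f is a nonzerodivisor modulo J + (a) *)
have [|k Jk] := monic_nonzerodiv idJa ccJa monf (g := h).
  exists g; have -> : f * h - g * a = - (a * g - h * f) by ring.
  exact: idlN.
exists k; apply: nza.
have -> : a * (g - k * f) = (a * g - h * f) + f * (h - k * a) by ring.
by apply: idlD => //; apply: idlMl.
Qed.

(** For [q = 1] this is the sequence [f_j = x f_1 ... f_(j-1) + a_j]; the
    accumulator [q] carries the product of the earlier terms, which makes [f_j]
    congruent to [a_j] modulo each of them. *)
Fixpoint lift_seq x q s : seq S :=
  if s is a :: s' then (x * q + a) :: lift_seq x (q * (x * q + a)) s' else [::].

Lemma size_lift_seq x q s : size (lift_seq x q s) = size s.
Proof. by elim: s q => //= a s IHs q; rewrite IHs. Qed.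

(** Either [x] or a factor of [q] lies in [J] where this is applied. *)
Lemma weakly_regular_lift J x q s : is_ideal J -> J (x * q) ->
  weakly_regular J s -> weakly_regular J (lift_seq x q s).
Proof.
elim: s J q => //= a s IHs J q idJ Jxq [nza reg].
have Jfa : J (a - (x * q + a)).
  have -> : a - (x * q + a) = - (x * q) by ring.
  exact: idlN.
split; first exact: (nonzerodiv_congr idJ Jfa nza).
rewrite -(adjoin_congr idJ Jfa); apply: IHs => //; first exact: adjoin_ideal.
by rewrite mulrA; apply: sub_adjoin => //; apply: idlMr.
Qed.

(** The clause for the tails is what the induction on the number of variables
    consumes: passing to [J : x] lowers the degrees of the generators by at most one,
    and the first element of the sequence is spent on [x] at the same time.
    The bound on [size s] excludes [J = 0] in too few variables. *)
Fixpoint universally_regular (m : nat) s : Prop :=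
  if s is a :: s' then
    (forall A, (forall u, A u ->
        [/\ squarefree_mon u, forall i, (m <= i)%N -> u i = 0%N
          & (size s < mdeg u)%N]) ->
     (size s <= m)%N -> weakly_regular (monomial_gen A) s)
    /\ universally_regular m s'
  else True.

Lemma universally_regularP m s A :
  universally_regular m s -> (size s <= m)%N ->
  (forall u, A u -> [/\ squarefree_mon u, forall i, (m <= i)%N -> u i = 0%N
          & (size s < mdeg u)%N]) ->
  weakly_regular (monomial_gen A) s.
Proof. by case: s => //= a s [+ _] lt_sm HA; apply. Qed.

Lemma colon_monomial_gen A i :
  colon (monomial_gen A) 'X_i =
  monomial_gen (fun v => exists2 u, A u & v = (u - U_(i))%MM) :> (S -> Prop).
Proof.
apply: pred_ext => g; split; rewrite /colon.
  move=> /monomial_genP Jg; apply/monomial_genP => w wg.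
  have [|u Au le_u] := Jg (U_(i) + w)%MM; first by apply/msuppXM; exists w.
  exists (u - U_(i))%MM; first by exists u.
  apply/mnm_lepP => j; move/mnm_lepP/(_ j): le_u; rewrite mnmBE mnmDE; lia.
apply: (@ideal_gen_min _ _ _ (colon (monomial_gen A) 'X_i)).
  exact/colon_ideal/monomial_gen_ideal.
move=> _ [_ [u Au ->] ->]; rewrite /colon -mpolyXD; apply/monomial_genX; exists u => //.
by apply/mnm_lepP => j; rewrite mnmDE mnmBE; lia.
Qed.

Lemma adjoin_monomial_gen A i :
  adjoin (monomial_gen A) 'X_i =
  adjoin (monomial_gen (fun u => A u /\ u i = 0%N)) 'X_i :> (S -> Prop).
Proof.
apply: pred_ext => f; split=> -[h]; last first.
  by move/monomial_gen_sub => Jf; exists h; apply: Jf => u [].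
set J' : S -> Prop := monomial_gen (fun u => A u /\ u i = 0%N).
have idJ' : is_ideal J' by apply: monomial_gen_ideal.
have idJ'x := adjoin_ideal 'X_i idJ'.
move=> Jf; rewrite -[f](subrK (h * 'X_i)); apply: (idlD idJ'x); last first.
  exact/(idlMl idJ'x)/adjoin_self.
move: Jf; apply: ideal_gen_min => // _ [u Au ->].
have [ui0|ui] := eqVneq (u i) 0%N.
  by apply: sub_adjoin => //; apply: mpolyX_gen.
rewrite (@mpolyX_divl n K U_(i)); last by rewrite lep1mP.
exact/(idlMl idJ'x)/adjoin_self.
Qed.

Lemma mdeg_squarefree u m : squarefree_mon u ->
  (forall i, (m <= i)%N -> u i = 0%N) -> (mdeg u <= m)%N.
Proof.
move=> sqf um; rewrite mdegE.
apply: (@leq_trans (\sum_(i < n) (i < m)%N)).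
  by apply: leq_sum => i _; have := sqf i; have [_|/um->] := ltnP i m.
suff H p : (\sum_(i < p) (i < m)%N <= minn p m)%N by apply: leq_trans (H n) (geq_minr _ _).
elim: p => [|p IHp]; first by rewrite big_ord0.
by rewrite big_ord_recr /=; move: IHp; move: (\sum_(_ < _) _)%N => t; lia.
Qed.

(** The induction on the number of variables. Every element of the lifted
    sequence is monic in the new variable [x], and is congruent to the element
    of [s] both modulo [x] and modulo each earlier element of the lifted
    sequence. Modulo [(J, x)] the lifted sequence therefore acts as [s]; modulo
    [J : x], where generators may have lost one degree, its head [f] is
    regular since it is monic, and its tail acts modulo [f] as the tail
    of [s]. *)
Lemma universally_regular_lift i q s :
  universally_regular i s -> (forall a, a \in s -> var_free i a) ->
  in_var i q \is monic -> universally_regular i.+1 (lift_seq 'X_i q s).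
Proof.
elim: s q => //= a s IHs q [ureg uregs] frs monq.
have fra : var_free i a by apply: frs; rewrite mem_head.
have {}frs b : b \in s -> var_free i b by move=> bs; apply: frs; rewrite inE bs orbT.
have monx : in_var i ('X_i : S) \is monic by rewrite in_varX eqxx monicX.
set f := 'X_i * q + a.
have monf : in_var i f \is monic.
  rewrite rmorphD rmorphM /= fra in_varX eqxx monicE lead_coefDl.
    by rewrite lead_coefM lead_coefX mul1r -monicE.
  rewrite mulrC size_mulX ?monic_neq0 // size_polyC ltnS.
  by rewrite (leq_trans (leq_b1 _)) // size_poly_gt0 monic_neq0.
split; last first.
  by apply: (IHs _ uregs frs); rewrite rmorphM (monicMl _ monq); exact: monf.
rewrite size_lift_seq => A HA lt_sm.
set J := monomial_gen A; have idJ : is_ideal J by apply: monomial_gen_ideal.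
set A' := fun v => exists2 u, A u & v = (u - U_(i))%MM.
have HA' v : A' v ->
    [/\ squarefree_mon v, forall j : 'I_n, (i <= j)%N -> v j = 0%N
       & (size s < mdeg v)%N].
  move=> [u /HA[sqf um lt_su] ->]; split=> [j|j|].
  - by rewrite mnmBE; have := sqf j; lia.
  - rewrite mnmBE leq_eqVlt => /orP[/eqP/val_inj<-|/um->//].
    by rewrite mnm1E eqxx; have := sqf i; lia.
  - have : (mdeg u <= mdeg (u - U_(i)) + 1)%N.
      rewrite -(mdeg1 i) -mdegD lem_mdeg //.
      by apply/mnm_lepP => j; rewrite mnmDE mnmBE; lia.
    lia.
have regc : weakly_regular (colon J 'X_i) (f :: lift_seq 'X_i (q * f) s).
  rewrite /J colon_monomial_gen -/A'.
  have ccA' : coef_closed i (monomial_gen A' : S -> Prop).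
    by apply: coef_closed_monomial_gen => v /HA'[_ v0 _]; apply: v0.
  have idA' : is_ideal (monomial_gen A' : S -> Prop) by apply: monomial_gen_ideal.
  split; first exact: monic_nonzerodiv monf.
  apply: weakly_regular_lift; first exact: adjoin_ideal.
    by rewrite mulrA; apply/(idlMl (adjoin_ideal f idA'))/adjoin_self.
  apply: (weakly_regular_add_monic idA' ccA' frs monf).
  exact: (universally_regularP uregs _ HA').
have [le_mi|lt_im] := leqP (size s).+1 i; last first.
  (* a squarefree monomial in i.+1 variables has degree at most i.+1, so that
     A is empty *)
  suff eqJ : colon J 'X_i = J by rewrite -eqJ.
  have noA u : ~ A u.
    by move=> /HA[sqf um]; have := mdeg_squarefree sqf um; lia.
  rewrite /J colon_monomial_gen; congr monomial_gen; apply: pred_ext => v.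
  by split=> [[u /noA]|/noA].
apply: weakly_regular_extension idJ regc _; rewrite /J adjoin_monomial_gen.
set A0 := fun u => _; have idA0 : is_ideal (monomial_gen A0 : S -> Prop).
  exact: monomial_gen_ideal.
apply: (@weakly_regular_lift _ 'X_i q (a :: s)); first exact: adjoin_ideal.
  by apply/(idlMr (adjoin_ideal 'X_i idA0))/adjoin_self.
apply: (@weakly_regular_add_monic i _ _ _ idA0 _ _ monx).
- by apply: coef_closed_monomial_gen => u [].
- by move=> b; rewrite inE => /orP[/eqP->|/frs].
apply: ureg => // u [/HA[sqf um lt_su] ui0]; split=> // j.
by rewrite leq_eqVlt => /orP[/eqP/val_inj<-|/um].
Qed.

(** In no variables at all the sequence of zeros qualifies vacuously. *)
Lemma universally_regular_exists m r : (m <= n)%N ->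
  exists s, [/\ size s = r, universally_regular m s,
    forall i : 'I_n, (m <= i)%N -> forall a, a \in s -> var_free i a
    & forall a : S, a \in s -> max_ideal a].
Proof.
elim: m => [|m IHm] le_mn.
  exists (nseq r 0); split; first by rewrite size_nseq.
  - by elim: r => //= r IHr; split=> // A _; rewrite ltn0.
  - by move=> i _ a; rewrite mem_nseq => /andP[_ /eqP->]; apply: var_free0.
  - move=> a; rewrite mem_nseq => /andP[_ /eqP->].
    exact: (idl0 (max_ideal_ideal n K)).
have [s [<- us frs ms]] := IHm (ltnW le_mn).
pose i := Ordinal le_mn; exists (lift_seq 'X_i 1 s).
split; first exact: size_lift_seq.
- apply: (@universally_regular_lift i); [exact: us | exact: frs | ].
  by rewrite rmorph1 monic1.
- move=> j lt_mj; have frj b : b \in s -> var_free j b by apply/frs/ltnW.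
  have : var_free j (1 : S) by apply: var_free1.
  elim: s 1 {us frs ms} frj => //= b s IHs q frj frq a.
  have frf : var_free j ('X_i * q + b).
    apply: var_freeD; last by apply: frj; rewrite mem_head.
    apply: var_freeM => //; apply: var_freeX.
    by rewrite -val_eqE /= ltn_eqF.
  rewrite inE => /orP[/eqP->//|]; apply: IHs; last exact: var_freeM.
  by move=> c cs; apply: frj; rewrite inE cs orbT.
- have idm := max_ideal_ideal n K.
  elim: s 1 {us frs} ms => //= b s IHs q ms a.
  rewrite inE => /orP[/eqP->|]; last first.
    by apply: IHs => c cs; apply: ms; rewrite inE cs orbT.
  apply: (idlD idm); last by apply: ms; rewrite mem_head.
  exact/(idlMr idm)/max_idealX.
Qed.

End UniversalSequence.

(** * The Koszul complex *)

(** The vanishing on the diagonal is a separate hypothesis, as 2 may be a zero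
    divisor. *)
Lemma sum_antisymmetric (R : comNzRingType) n (F : 'I_n -> 'I_n -> R) :
  (forall i, F i i = 0) -> (forall i j, F i j = - F j i) ->
  \sum_i \sum_j F i j = 0.
Proof.
move=> F0 Fanti.
have -> : \sum_i \sum_j F i j =
    \sum_(i < n) \sum_(j : 'I_n | (j < i)%N) F i j +
    \sum_(i < n) \sum_(j : 'I_n | (i < j)%N) F i j.
  rewrite -big_split; apply: eq_bigr => i _ /=.
  rewrite (bigID (fun j : 'I_n => j < i)%N) /=; congr (_ + _).
  rewrite (bigD1 i) ?ltnn //= F0 add0r; apply: eq_bigl => j.
  by rewrite -leqNgt ltn_neqAle eq_sym andbC.
rewrite [X in _ + X](exchange_big_dep xpredT) //= -big_split big1 //= => i _.
by rewrite -big_split big1 //= => j _; rewrite [F i j]Fanti addNr.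
Qed.

Section Koszul.
Variables (R : comNzRingType) (n : nat) (x : 'I_n -> R).
Implicit Types (i j : 'I_n) (A B : {set 'I_n}) (J : R -> Prop).

(** A Koszul chain, given by the coefficients of the exterior monomials
    [e_A]; no degree is imposed. *)
Definition chain := {set 'I_n} -> R.
Implicit Types c z : chain.

(** The sign of moving [e_i] past the factors of [e_A] with smaller index. *)
Definition sgn i A : R := (-1) ^+ #|[set j in A | (j < i)%N]|.

(** Contraction with the dual of [e_i]. *)
Definition contract i c : chain :=
  fun A => if i \in A then 0 else sgn i A * c (i |: A).

(** Exterior multiplication by [e_i]. *)
Definition wedge i c : chain :=
  fun A => if i \in A then sgn i A * c (A :\ i) else 0.

Definition del c : chain := fun A => \sum_i x i * contract i c A.

Lemma sgn_sqr i A : sgn i A * sgn i A = 1.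
Proof. by rewrite -expr2 sqrr_sign. Qed.

Lemma sgnU i j A : j \notin A ->
  sgn i (j |: A) = (if (j < i)%N then -1 else 1) * sgn i A.
Proof.
move=> jA; rewrite /sgn; case: ifP => lt_ji.
  rewrite -exprS; congr (_ ^+ _).
  rewrite (_ : [set k in j |: A | (k < i)%N] = j |: [set k in A | (k < i)%N]).
    by rewrite cardsU1 inE negb_and jA.
  by apply/setP => k; rewrite !inE; case: eqP => [->|]; rewrite ?lt_ji.
rewrite mul1r; congr (_ ^+ _); apply: eq_card => k; rewrite !inE.
by case: eqP => [->|]; rewrite ?lt_ji ?andbF.
Qed.

Lemma sgnD i j A : j \in A ->
  sgn i A = (if (j < i)%N then -1 else 1) * sgn i (A :\ j).
Proof. by move=> jA; rewrite -{1}(setD1K jA) sgnU // !inE eqxx. Qed.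

Lemma sgnD1 i A : sgn i (A :\ i) = sgn i A.
Proof.
congr (_ ^+ _); apply: eq_card => k; rewrite !inE.
by case: eqP => [->|]; rewrite ?ltnn ?andbF.
Qed.

Lemma contract_contract i j c A :
  contract i (contract j c) A = - contract j (contract i c) A.
Proof.
rewrite /contract; have [->|ne_ij] := eqVneq i j.
  by case: ifP => _; rewrite ?setU11 ?mulr0 oppr0.
rewrite !in_setU1 eq_sym (negbTE ne_ij) /=.
have [iA|iA] := boolP (i \in A); have [jA|jA] := boolP (j \in A);
  rewrite ?(negbTE ne_ij) ?mulr0 ?oppr0 //=; last first.
rewrite !sgnU // setUCA.
have [lt_ij|lt_ji|/val_inj eq_ij] := ltngtP i j; last by rewrite eq_ij eqxx in ne_ij.
- ring.
- ring.
Qed.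

Lemma contract_wedge i c A :
  contract i (wedge i c) A + wedge i (contract i c) A = c A.
Proof.
rewrite /contract /wedge; have [iA|iA] := boolP (i \in A).
  by rewrite add0r !inE eqxx /= setD1K // sgnD1 mulrA sgn_sqr mul1r.
rewrite setU11 addr0 setU1K // -(sgnD1 i (i |: A)) setU1K //.
by rewrite mulrA sgn_sqr mul1r.
Qed.

Lemma contract_wedgeN i j c A : i != j ->
  contract i (wedge j c) A = - wedge j (contract i c) A.
Proof.
move=> ne_ij; rewrite /contract /wedge !inE (eq_sym j) (negbTE ne_ij) /=.
have [iA|iA] := boolP (i \in A); have [jA|jA] := boolP (j \in A);
  rewrite ?mulr0 ?oppr0 //=.
have -> : (i |: A) :\ j = i |: (A :\ j).
  apply/setP => k; rewrite !inE; case: (eqVneq k i) => [->|] //=.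
  by rewrite ne_ij.
rewrite sgnU // (sgnD i jA).
have [lt_ij|lt_ji|/val_inj eq_ij] := ltngtP i j; last by rewrite eq_ij eqxx in ne_ij.
- ring.
- ring.
Qed.

Lemma contract_del i c A : contract i (del c) A = \sum_j x j * contract i (contract j c) A.
Proof.
rewrite /contract; case: ifP => iA.
  by rewrite big1 // => j _; rewrite mulr0.
by rewrite /del mulr_sumr; apply: eq_bigr => j _; rewrite mulrCA.
Qed.

Lemma wedge_del i c A : wedge i (del c) A = \sum_j x j * wedge i (contract j c) A.
Proof.
rewrite /wedge; case: ifP => iA; last by rewrite big1 // => j _; rewrite mulr0.
by rewrite /del mulr_sumr; apply: eq_bigr => j _; rewrite mulrCA.
Qed.

Lemma del_del c A : del (del c) A = 0.
Proof.
rewrite {1}/del; under eq_bigr do rewrite contract_del mulr_sumr.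
apply: sum_antisymmetric => [i|i j].
  by rewrite /contract; case: ifP => _; rewrite ?setU11 !mulr0.
by rewrite contract_contract; ring.
Qed.

Lemma del_wedge i c A : del (wedge i c) A = x i * c A - wedge i (del c) A.
Proof.
rewrite wedge_del {1}/del (bigD1 i) //= [X in _ - X](bigD1 i) //=.
rewrite -(contract_wedge i c A) mulrDr opprD addrA addrK; congr (_ + _).
rewrite -sumrN; apply: eq_bigr => j ne_ji.
by rewrite contract_wedgeN // mulrN.
Qed.

Lemma contractD i c z A :
  contract i (fun B => c B + z B) A = contract i c A + contract i z A.
Proof. by rewrite /contract; case: ifP; rewrite ?addr0 ?mulrDr. Qed.

Lemma delD c z A : del (fun B => c B + z B) A = del c A + del z A.
Proof.
by rewrite /del -big_split; apply: eq_bigr => i _; rewrite contractD mulrDr.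
Qed.

Lemma delM a c A : del (fun B => a * c B) A = a * del c A.
Proof.
rewrite /del mulr_sumr; apply: eq_bigr => i _; rewrite /contract.
by case: ifP => _; ring.
Qed.

Lemma delB c z A : del (fun B => c B - z B) A = del c A - del z A.
Proof.
have -> : (fun B => c B - z B) = (fun B => c B + -1 * z B).
  by apply: functional_extensionality => B; rewrite mulN1r.
by rewrite delD delM mulN1r.
Qed.

Lemma del_sum (I : Type) (r : seq I) (F : I -> chain) A :
  del (fun B => \sum_(k <- r) F k B) A = \sum_(k <- r) del (F k) A.
Proof.
elim: r => [|k r IHr].
  rewrite big_nil /del big1 // => i _; rewrite /contract big_nil.
  by case: ifP; rewrite !mulr0.
rewrite big_cons -IHr -delD; congr del.
by apply: functional_extensionality => B; rewrite big_cons.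
Qed.

Lemma contract_mem J i c A : is_ideal J -> (forall B, J (c B)) -> J (contract i c A).
Proof.
move=> idJ Jc; rewrite /contract.
by case: ifP => _; [exact: (idl0 idJ) | exact/(idlMl idJ)].
Qed.

Lemma del_mem J c A :
  is_ideal J -> (forall i B, J (x i * c B)) -> J (del c A).
Proof.
move=> idJ Jxc; apply: (idl_sum idJ) => i _.
exact: (contract_mem i A (colon_ideal (x i) idJ) (Jxc i)).
Qed.

Lemma wedge_mem J i c A : is_ideal J -> (forall B, J (c B)) -> J (wedge i c A).
Proof.
move=> idJ Jc; rewrite /wedge.
by case: ifP => _; [exact/(idlMl idJ) | exact: (idl0 idJ)].
Qed.

Definition degree_geq k c : Prop := forall A, (#|A| < k)%N -> c A = 0.

Lemma degree_geq_wedge k i c : degree_geq k c -> degree_geq k.+1 (wedge i c).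
Proof.
move=> ck A lt_A; rewrite /wedge; case: ifP => // iA.
by rewrite ck ?mulr0 //; move: lt_A; rewrite (cardsD1 i) iA.
Qed.

Lemma degree_geq_del k c : degree_geq k c -> degree_geq k.-1 (del c).
Proof.
move=> ck A lt_A; rewrite /del big1 // => i _; rewrite /contract.
case: ifP => iA; rewrite ?mulr0 // ck ?mulr0 // cardsU1 iA.
by move: lt_A; case: (k).
Qed.

(** Exterior multiplication by [e_P], the product of the [e_i] for [i] in [P]. *)
Definition wedges (P : seq 'I_n) c : chain := foldr wedge c P.

Lemma wedges_mem J P c A : is_ideal J -> (forall B, J (c B)) -> J (wedges P c A).
Proof.
by move=> idJ Jc; elim: P A => //= i P IHP A; apply: (wedge_mem i A idJ).
Qed.

Lemma degree_geq_wedges k P c :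
  degree_geq k c -> degree_geq (size P + k) (wedges P c).
Proof. by move=> ck; elim: P => //= i P IHP; apply: degree_geq_wedge. Qed.

(** Up to sign, [del (e_P c)] is [(del e_P) c] for a cycle [c], and the
    coefficients of [del e_P] are the [x_i] with [i] in [P]. *)
Lemma del_wedges_mem J P c A : is_ideal J -> (forall B, del c B = 0) ->
  (forall i, i \in P -> forall B, J (x i * c B)) -> J (del (wedges P c) A).
Proof.
move=> idJ c0; elim: P A => [|i P IHP] A /= Jxc.
  by rewrite c0; apply: (idl0 idJ).
rewrite del_wedge; apply: (idlB idJ).
  apply: (@wedges_mem (colon J (x i))); first exact: colon_ideal.
  by apply: Jxc; rewrite mem_head.
apply: (wedge_mem i A idJ) => B; apply: IHP => j jP; apply: Jxc.
by rewrite inE jP orbT.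
Qed.

Definition boundary_mod J c : Prop := exists z, forall A, J (c A - del z A).

(** An element [a] of the ideal [(x)] kills the Koszul homology of [R/J]: if
    [a = sum_i b_i x_i], then [c |-> sum_i b_i e_i c] is a homotopy. When [a]
    is also regular on [R/J], the chain [z] with [del z = a c] modulo [J] is a
    cycle modulo [J + (a)], and a boundary only if [c] is one; hence every
    element of a regular sequence raises by one the degree of a nonzero Koszul
    class, and this degree is at most [n]. *)
Theorem koszul_cycle_bound J (s : seq R) c k : is_ideal J ->
  weakly_regular J s ->
  (forall a, a \in s -> exists b : 'I_n -> R, a = \sum_i b i * x i) ->
  degree_geq k c -> (forall A, J (del c A)) -> ~ boundary_mod J c ->
  (size s + k <= n)%N.
Proof.
elim: s J c k => [|a s IHs] J c k idJ /=.
  move=> _ _ ck _ cnb; rewrite leqNgt; apply/negP => lt_nk; apply: cnb.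
  have c0 A : c A = 0.
    by apply: ck; apply: leq_ltn_trans lt_nk; rewrite -[n in leqRHS]card_ord max_card.
  exists c => A; have -> : del c A = 0.
    rewrite /del big1 // => i _; rewrite /contract c0.
    by case: ifP; rewrite !mulr0.
  by rewrite c0 subr0; apply: idl0.
move=> [nza reg] sx ck cyc cnb.
have [|b def_a] := sx a; first by rewrite mem_head.
pose z : chain := fun A => \sum_i b i * wedge i c A.
have del_z A : del z A = a * c A - \sum_i b i * wedge i (del c) A.
  rewrite del_sum def_a mulr_suml -sumrB; apply: eq_bigr => i _.
  by rewrite delM del_wedge mulrBr mulrA.
rewrite addSnnS; apply: (IHs (adjoin J a) z) => //.
- exact: adjoin_ideal.
- by move=> e es; apply: sx; rewrite inE es orbT.
- move=> A lt_A; rewrite /z big1 // => i _.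
  by rewrite (degree_geq_wedge i ck) // mulr0.
- move=> A; exists (c A); have -> : del z A - c A * a = - \sum_i b i * wedge i (del c) A.
    by rewrite del_z; ring.
  apply: (idlN idJ); apply: (idl_sum idJ) => i _; apply: (idlMl idJ).
  exact: (wedge_mem i A idJ).
move=> [w /fin_all_exists[y Hy]]; apply: cnb; exists y => A; apply: nza.
have del_y : J (del z A - a * del y A).
  have -> : del z A - a * del y A = del (fun B => z B - del w B - y B * a) A.
    rewrite !delB del_del subr0; congr (_ - _); rewrite -delM; congr del.
    by apply: functional_extensionality => B; rewrite mulrC.
  by apply: del_mem => // i B; apply: (idlMl idJ).
have -> : a * (c A - del y A) =
    (\sum_i b i * wedge i (del c) A) + (del z A - a * del y A).
  by rewrite del_z; ring.
apply: (idlD idJ) => //; apply: (idl_sum idJ) => i _; apply: (idlMl idJ).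
exact: (wedge_mem i A idJ).
Qed.

End Koszul.

(** * The cycle of transversals of a partition *)

Section TransversalCycle.
Variables (n : nat) (K : fieldType).
Local Notation S := {mpoly K[n]}.
Local Notation xchain := (chain S n).
Local Notation xdel := (@del S n (fun i => 'X_i)).
Implicit Types (i : 'I_n) (A B : {set 'I_n}) (c z : xchain) (u v w : 'X_{1..n}).

Lemma mcoeff_sgn i A (f : S) w : ((sgn S i A * f)@_w == 0) = (f@_w == 0).
Proof.
rewrite /sgn -signr_odd; case: (odd _); first by rewrite expr1 mulN1r mcoeffN oppr_eq0.
by rewrite expr0 mul1r.
Qed.

Lemma wedgeU i c A : i \notin A -> wedge i c (i |: A) = sgn S i (i |: A) * c A.
Proof. by move=> iA; rewrite /wedge setU11 setU1K. Qed.

Lemma wedges_coeff_neq0 (P : seq 'I_n) c A w : uniq P -> {in P, forall i, i \notin A} ->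
  (c A)@_w != 0 -> (wedges P c ([set i in P] :|: A))@_w != 0.
Proof.
move=> + + nz; elim: P => [|i P IHP] /=.
  by rewrite (_ : [set i in [::]] = set0) ?set0U //; apply/setP => i; rewrite !inE.
move=> /andP[iP uP] PA; rewrite set_cons -setUA wedgeU.
  by rewrite mcoeff_sgn; apply: IHP => // j jP; apply: PA; rewrite inE jP orbT.
by rewrite !inE negb_or iP PA // mem_head.
Qed.

(** Of the terms of [(del e_P) c], only the one that omits [e_b] contributes to
    this coefficient, since [w] involves no variable of [P]; so there is no
    cancellation. *)
Lemma del_wedges_coeff_neq0 (P : seq 'I_n) c A w b :
  uniq P -> {in P, forall i, i \notin A} -> {in P, forall i, w i = 0%N} ->
  (c A)@_w != 0 -> (forall B, xdel c B = 0) -> b \in P ->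
  (xdel (wedges P c) ([set i in P] :\ b :|: A))@_(U_(b) + w)%MM != 0.
Proof.
move=> + + + nz c0; elim: P => //= i P IHP /andP[iP uP] PA Pw.
have PA' : {in P, forall j, j \notin A} by move=> j jP; apply: PA; rewrite inE jP orbT.
have Pw' : {in P, forall j, w j = 0%N} by move=> j jP; apply: Pw; rewrite inE jP orbT.
have iA : i \notin A by apply: PA; rewrite mem_head.
rewrite del_wedge inE; have [-> _|ne_bi /= bP] := eqVneq b i.
  rewrite set_cons setU1K ?inE // /wedge !inE (negbTE iP) (negbTE iA) subr0.
  by rewrite mulrC mcoeffMX; apply: wedges_coeff_neq0.
have -> : [set j in i :: P] :\ b :|: A = i |: ([set j in P] :\ b :|: A).
  apply/setP => j; rewrite !inE; case: (eqVneq j i) => [->|] //=.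
  by rewrite eq_sym ne_bi.
rewrite mcoeffB wedgeU; last by rewrite !inE negb_or negb_and iP iA orbT.
set f := wedges P c _; have -> : ('X_i * f)@_(U_(b) + w)%MM = 0.
  apply/eqP; rewrite mcoeff_eq0; apply/negP => /msuppXM[v _ /mnmP/(_ i)].
  by rewrite !mnmDE !mnm1E eqxx (negbTE ne_bi) Pw ?mem_head.
by rewrite sub0r oppr_eq0 mcoeff_sgn; apply: IHP.
Qed.

Variables (lvl : 'I_n -> nat).

Definition part l : seq 'I_n := enum [pred i | lvl i == l].

(** With [e_P] the exterior product of the [e_i] for [i] in [P], this is the
    product of the [del e_P] over the first [j] parts, up to sign. *)
Fixpoint transversal_cycle j : xchain :=
  if j is j'.+1 then xdel (wedges (part j') (transversal_cycle j'))
  else fun A => (A == set0)%:R.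

Definition transversal_monomial j u : Prop :=
  exists2 t : nat -> 'I_n, (forall l, (l < j)%N -> lvl (t l) = l)
                         & u = (\sum_(l < j) U_(t l))%MM.

Lemma mem_part l i : (i \in part l) = (lvl i == l).
Proof. by rewrite mem_enum. Qed.

Lemma del_transversal_cycle j A : xdel (transversal_cycle j) A = 0.
Proof.
case: j => [|j] /=; last exact: del_del.
rewrite /del big1 // => i _; rewrite /contract.
case: ifP => _; rewrite ?mulr0 //.
suff -> : (i |: A == set0) = false by rewrite !mulr0.
by apply/negbTE/set0Pn; exists i; rewrite setU11.
Qed.

Lemma transversal_cycle_mem (i0 : 'I_n) j A :
  monomial_gen (transversal_monomial j) (transversal_cycle j A).
Proof.
elim: j A => [|j IHj] A /=.
  case: eqP => _; last exact: (idl0 (monomial_gen_ideal _)).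
  rewrite -mpolyX0; apply: mpolyX_gen.
  by exists (fun=> i0) => //; rewrite big_ord0.
apply: del_wedges_mem; first exact: monomial_gen_ideal.
  exact: del_transversal_cycle.
move=> i; rewrite mem_part => /eqP lvli B.
move: (transversal_cycle j B) (IHj B) => f {IHj}.
have idJ := monomial_gen_ideal (K := K) (transversal_monomial j.+1).
apply: (@ideal_gen_min _ _ _ (colon (monomial_gen (transversal_monomial j.+1)) 'X_i)).
  exact: colon_ideal.
move=> _ [_ [t tP ->] ->]; rewrite /colon -mpolyXD; apply: mpolyX_gen.
exists (fun l => if (l < j)%N then t l else i) => [l|].
  rewrite ltnS; case: ltnP => [/tP //|le_jl le_lj].
  by apply/eqP; rewrite lvli eqn_leq le_jl le_lj.
rewrite big_ord_recr /= ltnn addmC; congr (_ + _)%MM.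
by apply: eq_bigr => l _; rewrite ltn_ord.
Qed.

(** Differentiation lowers the exterior degree by one for each part. *)
Lemma transversal_cycle_degree j :
  degree_geq (\sum_(l < j) size (part l) - j) (transversal_cycle j).
Proof.
elim: j => [|j IHj]; first by move=> A; rewrite big_ord0.
have /(degree_geq_del (fun i => 'X_i)) := degree_geq_wedges (P := part j) IHj.
move=> deg A lt_A; apply: deg; move: lt_A; rewrite big_ord_recr /=.
move: (size _) (\sum_(_ < _) _)%N => p N; lia.
Qed.

(** A representative [b l] of each part singles out one term of the product. *)
Lemma transversal_cycle_coeff (b : nat -> 'I_n) j : (forall l, (l < j)%N -> lvl (b l) = l) ->
  (transversal_cycle j [set i | (lvl i < j)%N && (i != b (lvl i))])
    @_(\sum_(l < j) U_(b l))%MM != 0.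
Proof.
elim: j => [|j IHj] bP.
  rewrite big_ord0 /=; set A := [set i | _].
  suff -> : A = set0 by rewrite eqxx mcoeff1 eqxx oner_eq0.
  by apply/setP => i; rewrite !inE.
rewrite big_ord_recr /= addmC.
have -> : [set i | (lvl i < j.+1)%N && (i != b (lvl i))] =
  [set i in part j] :\ b j :|: [set i | (lvl i < j)%N && (i != b (lvl i))].
  apply/setP => i; rewrite !inE mem_part.
  by case: (ltngtP (lvl i) j) => [lt|lt|->]; rewrite ?andbF ?orbF ?andbT //; lia.
apply: del_wedges_coeff_neq0.
- exact: enum_uniq.
- by move=> i; rewrite mem_part inE => /eqP->; rewrite ltnn.
- move=> i; rewrite mem_part => /eqP lvli; rewrite mnm_sumE big1 // => l _.
  rewrite mnm1E; case: eqP => // bl; have lt_lj := ltn_ord l.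
  by have := bP l (ltnW lt_lj); rewrite bl lvli; lia.
- by apply: IHj => l lt_lj; apply/bP/ltnW.
- exact: del_transversal_cycle.
- by rewrite mem_part bP.
Qed.

(** The chain [omega] is the product of the [del e_P] over all parts [P] but the
    last, for which [e_P] itself is taken; its exterior degree is [n - D + 1].
    The differential of [omega] is the transversal cycle, with coefficients in
    [J], one of which has a term of degree [D]. If [omega] were a boundary
    modulo [J], this differential would be that of a chain with coefficients in
    [J], whose terms all have degree greater than [D]. *)
Theorem regular_seq_lt_parts (J : S -> Prop) (s : seq S) D : is_ideal J ->
  (forall f, J f -> forall w, w \in msupp f -> (D <= mdeg w)%N) ->
  (0 < D)%N -> (forall i, (lvl i < D)%N) ->
  (forall l, (l < D)%N -> exists i, lvl i = l) ->
  (forall u, transversal_monomial D u -> J 'X_[u]) ->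
  (forall f, f \in s -> max_ideal f) -> weakly_regular J s -> (size s < D)%N.
Proof.
(* D now becomes the index of the last part *)
move=> idJ degJ; case: D degJ => // D degJ _ lvlD lvl_surj transJ ms reg.
have [i0 _] := lvl_surj 0%N isT.
have {lvl_surj}[b bP] : exists b : nat -> 'I_n, forall l, (l < D.+1)%N -> lvl (b l) = l.
  have /fin_all_exists[b bP] : forall l : 'I_D.+1, exists i, lvl i = l.
    by move=> l; apply: lvl_surj.
  by exists (fun l => b (inord l)) => l lt_lD; rewrite bP inordK.
have le_Dn : (D.+1 <= n)%N.
  have inj : injective (fun l : 'I_D.+1 => b l).
    by move=> l l' /(congr1 lvl); rewrite !bP // => /val_inj.
  by have := leq_card _ inj; rewrite !card_ord.
have sum_part : (\sum_(l < D.+1) size (part l) = n)%N.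
  transitivity (\sum_(l < D.+1) \sum_(i | lvl i == l) 1)%N.
    by apply: eq_bigr => l _; rewrite -sum1_size big_enum.
  rewrite -[RHS]card_ord -sum1_card (exchange_big_dep xpredT) //=; apply: eq_bigr => i _.
  rewrite (bigD1 (Ordinal (lvlD i))) ?inE //= big1 // => l /andP[/eqP eq_l].
  by rewrite -val_eqE /= eq_l eqxx.
pose omega := wedges (part D) (transversal_cycle D).
have deg_omega : degree_geq (n - D) omega.
  have deg := degree_geq_wedges (P := part D) (@transversal_cycle_degree D).
  move=> A lt_A; apply: deg; apply: leq_trans lt_A _.
  move: sum_part; rewrite big_ord_recr /=.
  move: (size _) (\sum_(_ < _) _)%N => p N; lia.
have cyc A : J (xdel omega A).
  have := @transversal_cycle_mem i0 D.+1 A; apply: ideal_gen_min => //.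
  by move=> _ [u /transJ Ju ->].
have nb : ~ boundary_mod (fun i => 'X_i) J omega.
  move=> [z Hz].
  pose g : xchain := fun A => omega A - xdel z A.
  have del_g A : xdel g A = transversal_cycle D.+1 A by rewrite delB del_del subr0.
  have /eqP := transversal_cycle_coeff bP; apply.
  apply/eqP; rewrite -del_g mcoeff_eq0; apply/negP.
  set w := (\sum_(_ < _) _)%MM; have deg_w : mdeg w = D.+1.
    rewrite mdeg_sum (eq_bigr (fun=> 1%N)) => [|l _]; last by rewrite mdeg1.
    by rewrite sum1_card card_ord.
  suff H A f : f = xdel g A -> w \in msupp f -> (D.+1 < mdeg w)%N.
    by move/(H _ _ erefl); rewrite deg_w ltnn.
  move=> ->; pose J2 (f : S) := forall w, w \in msupp f -> (D.+1 < mdeg w)%N.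
  have idJ2 : is_ideal J2.
    by apply: msupp_ideal => u v; rewrite mdegD => lt_Dv; apply: ltn_addl.
  have : J2 (xdel g A); last by apply.
  apply: del_mem => // i B v /msuppXM[u ug ->]; rewrite mdegD mdeg1 add1n ltnS.
  exact: degJ (Hz B) _ ug.
have mx a : a \in s -> exists c : 'I_n -> S, a = \sum_i c i * 'X_i.
  move=> /ms.
  apply: (@ideal_gen_min _ _ _ (fun a : S => exists c : 'I_n -> S, a = \sum_i c i * 'X_i)).
    split=> [|_ _ [c ->] [d ->]|f _ [c ->]].
    - by exists (fun=> 0); rewrite big1 // => i _; rewrite mul0r.
    - exists (fun i => c i + d i); rewrite -big_split; apply: eq_bigr => i _.
      by rewrite mulrDl.
    - exists (fun i => f * c i); rewrite mulr_sumr; apply: eq_bigr => i _.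
      by rewrite mulrA.
  move=> _ [i ->]; exists (fun j => (j == i)%:R).
  rewrite (bigD1 i) //= eqxx mul1r big1 ?addr0 // => j /negbTE->.
  by rewrite mul0r.
have := koszul_cycle_bound idJ reg mx deg_omega cyc nb.
by move: (size s) => r; lia.
Qed.

End TransversalCycle.

(** * Matroids: unions, and flags of flats *)

Section Matroid.
Variable T : finType.
Implicit Types (A B X Y F H : {set T}) (e x y : T) (ind : {set T} -> Prop).

Definition matroid_independence ind : Prop :=
  [/\ ind set0, forall A B, A \subset B -> ind B -> ind A
    & forall A B, ind A -> ind B -> (#|A| < #|B|)%N ->
        exists2 e, e \in B :\: A & ind (e |: A)].

Lemma cardsD_eq A B : #|A| = #|B| -> #|A :\: B| = #|B :\: A|.
Proof. by move=> eqAB; rewrite !cardsD eqAB setIC. Qed.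

(** With [A] in the basis [B1] and [B] in the basis [B2], exchanges with [B1]
    push [B2] into the union of [B] and [B1]; if no augmentation exists then
    [B1] lies in the union of [A] and [B2] as well, and comparing the two
    differences gives [#|B| <= #|A|]. *)
Lemma bases_matroid_independence (basis : {set T} -> Prop) d :
  (exists B, basis B) -> (forall B, basis B -> #|B| = d) ->
  (forall A B, basis A -> basis B -> forall x, x \in A :\: B ->
     exists2 y, y \in B :\: A & basis (y |: A :\ x)) ->
  matroid_independence (fun A => exists2 B, basis B & A \subset B).
Proof.
move=> [B0 B0P] cardB exch; split.
- by exists B0; rewrite ?sub0set.
- by move=> A B AB [C CP BC]; exists C => //; apply: subset_trans BC.
move=> A B [B1 B1P AB1] [B2 B2P BB2] lt_AB.
have [m] := ubnP #|B2 :\: (B :|: B1)|; elim: m B2 B2P BB2 => // m IHm B2 B2P BB2 lt_m.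
have [/eqP|[x]] := set_0Vmem (B2 :\: (B :|: B1)); last first.
  rewrite !inE negb_or => /andP[/andP[xB xB1] xB2].
  have [|y] := exch B2 B1 B2P B1P x; first by rewrite inE xB1.
  rewrite inE => /andP[yB2 yB1] B2'P; apply: (IHm _ B2'P).
    apply/subsetP => e eB; rewrite !inE (subsetP BB2) // andbT.
    by apply/orP; right; apply: contraNneq xB => <-.
  move: lt_m; rewrite ltnS; apply: leq_trans; apply: proper_card.
  apply/properP; split; last first.
    exists x; rewrite !inE ?eqxx ?negb_or ?xB ?xB1 //= orbF.
    by case: eqP => // xy; rewrite xy yB1 in xB1.
  apply/subsetP => e; rewrite !inE; case: (eqVneq e y) => [->|_] /=.
    by rewrite yB1 orbT.
  by case/andP => -> /andP[].
rewrite setD_eq0 => B2sub.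
have [/eqP|[e]] := set_0Vmem ((B :&: B1) :\: A); last first.
  rewrite !inE => /andP[eA /andP[eB eB1]]; exists e; first by rewrite inE eA.
  by exists B1 => //; rewrite subUset sub1set eB1.
rewrite setD_eq0 => BB1A.
have [/eqP|[x]] := set_0Vmem (B1 :\: (A :|: B2)); last first.
  rewrite !inE negb_or => /andP[/andP[xA xB2] xB1].
  have [|y] := exch B1 B2 B1P B2P x; first by rewrite inE xB2.
  rewrite inE => /andP[yB1 yB2] B1'P; exists y.
    have := subsetP B2sub y yB2; rewrite !inE (negbTE yB1) orbF => ->.
    by rewrite andbT; apply: contra yB1; apply: subsetP.
  exists (y |: B1 :\ x) => //; apply: setUS; apply/subsetP => e eA.
  by rewrite !inE (subsetP AB1) // andbT; apply: contraNneq xA => <-.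
rewrite setD_eq0 => B1sub.
have sub1 : B1 :\: B2 \subset A :\: B.
  apply/subsetP => e; rewrite !inE => /andP[eB2 eB1].
  have := subsetP B1sub e eB1; rewrite inE (negbTE eB2) orbF => ->.
  by rewrite andbT; apply: contra eB2; apply: subsetP.
have sub2 : B :\: A \subset B2 :\: B1.
  apply/subsetP => e; rewrite !inE => /andP[eA eB]; rewrite (subsetP BB2) // andbT.
  by apply: contra eA => eB1; apply: (subsetP BB1A); rewrite inE eB.
have : (#|B :\: A| <= #|A :\: B|)%N.
  apply: leq_trans (subset_leq_card sub2) _.
  have -> : #|B2 :\: B1| = #|B1 :\: B2| by apply: cardsD_eq; rewrite !cardB.
  exact: subset_leq_card.
rewrite !cardsD setIC.
have := subset_leq_card (subsetIl A B); have := subset_leq_card (subsetIr A B).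
move: lt_AB; lia.
Qed.

Definition color_class k (g : T -> 'I_k) X c : {set T} := [set e in X | g e == c].

(** A colouring of all of [T] encodes the partition of [X] into [k] parts. *)
Definition union_independent k ind X : Prop :=
  exists g : T -> 'I_k, forall c, ind (color_class g X c).

Lemma card_color_class k (g : T -> 'I_k) X : #|X| = (\sum_c #|color_class g X c|)%N.
Proof.
rewrite -sum1_card (partition_big g xpredT) //=; apply: eq_bigr => c _.
by rewrite -sum1_card; apply: eq_bigl => e; rewrite inE.
Qed.

(** The matroid union theorem. Given colourings [g] of [A] and [h] of [B],
    some colour class of [A] is smaller than that of [B], and can be augmented
    by an [e] of the latter. If [e] is new to [A], this augments [A];
    otherwise [e] is recoloured, after which [g] and [h] agree at one more
    point. *)
Lemma union_matroid_independence k ind : (0 < k)%N ->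
  matroid_independence ind -> matroid_independence (union_independent k ind).
Proof.
case: k => // k _ [ind0 indS indU]; split.
- exists (fun=> ord0) => c; rewrite (_ : color_class _ _ _ = set0) //.
  by apply/setP => e; rewrite !inE.
- move=> A B AB [g gP]; exists g => c; apply: indS (gP c).
  by apply/subsetP => e; rewrite !inE => /andP[/(subsetP AB)-> ->].
move=> A B [g gP] [h hP] lt_AB.
have [m] := ubnP (#|A| - #|[set e in A :&: B | g e == h e]|)%N.
elim: m g gP => // m IHm g gP lt_m.
have [c lt_c] : exists c, (#|color_class g A c| < #|color_class h B c|)%N.
  apply/existsP; apply: contraLR lt_AB; rewrite negb_exists -leqNgt => /forallP ge_c.
  rewrite (card_color_class g A) (card_color_class h B); apply: leq_sum => c _.
  by rewrite leqNgt ge_c.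
have [e] := indU _ _ (gP c) (hP c) lt_c; rewrite !inE negb_and.
case/andP => neA /andP[eB /eqP hec] ind_e.
pose g' x := if x == e then c else g x.
have g'P X c' : (forall x, x != e -> x \in X -> x \in A) ->
    ind (color_class g' X c').
  move=> XA; have [->|ne_c] := eqVneq c' c.
    apply: indS ind_e; apply/subsetP => x; rewrite !inE /g'.
    by case: (eqVneq x e) => //= ne_xe /andP[/(XA _ ne_xe)-> ->].
  apply: indS (gP c'); apply/subsetP => x; rewrite !inE /g'.
  case: (eqVneq x e) => [_|ne_xe]; first by rewrite eq_sym (negbTE ne_c) andbF.
  by move=> /andP[/(XA _ ne_xe)-> ->].
have [eA|eA] := boolP (e \in A); last first.
  exists e; first by rewrite inE eA.
  exists g' => c'; apply: g'P => x ne_xe; rewrite !inE (negbTE ne_xe) //.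
rewrite eA /= in neA.
apply: (IHm g'); first by move=> c'; apply: g'P.
have lt_agree : (#|[set x in A :&: B | g x == h x]|
    < #|[set x in A :&: B | g' x == h x]|)%N.
  apply: proper_card; apply/properP; split.
    apply/subsetP => x; rewrite !inE /g'; case: (eqVneq x e) => [->|//].
    by rewrite eA eB hec eqxx.
  by exists e; rewrite !inE eA eB /= hec; [rewrite /g' !eqxx | exact: neA].
have sub : (#|[set x in A :&: B | g' x == h x]| <= #|A|)%N.
  by apply/subset_leq_card/subsetP => x; rewrite !inE => /andP[/andP[]].
move: lt_m lt_agree sub; lia.
Qed.

Lemma card_inj_lt X (f : T -> nat) D : {in X &, injective f} ->
  (forall e, e \in X -> (f e < D)%N) -> (#|X| <= D)%N.
Proof.
move=> inj ltD; rewrite cardE -(size_map f) -(size_iota 0 D).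
apply: uniq_leq_size.
  by rewrite map_inj_in_uniq ?enum_uniq // => x y; rewrite !mem_enum; apply: inj.
by move=> l /mapP[e]; rewrite mem_enum mem_iota => /ltD lt_eD ->.
Qed.

Lemma set_of_pred (P : T -> Prop) : exists X : {set T}, forall e, e \in X <-> P e.
Proof.
have /fin_all_exists[b bP] : forall e, exists b : bool, b <-> P e.
  by move=> e; have [Pe|nPe] := classic (P e); [exists true | exists false].
by exists [set e | b e] => e; rewrite inE.
Qed.

(** The levels are the differences of a flag of flats: removing from [F] the
    complement of a hyperplane [H] spanned by all but one element of a basis
    leaves a set of smaller rank, and an independent [D]-subset of [H] stays
    independent when an element outside [H] is added. *)
Lemma independent_transversals ind D F B : matroid_independence ind ->
  (forall e, e \in F -> ind [set e]) ->
  B \subset F -> ind B -> #|B| = D ->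
  (forall X, X \subset F -> ind X -> (#|X| <= D)%N) ->
  exists lvl : T -> nat,
    [/\ forall e, e \in F -> (lvl e < D)%N,
        forall l, (l < D)%N -> exists2 e, e \in F & lvl e = l
      & forall X, X \subset F -> {in X &, injective lvl} -> #|X| = D -> ind X].
Proof.
move=> [ind0 indS indU].
elim: D F B => [|D IHD] F B loopless BF indB cardB rankF.
  exists (fun=> 0%N); split=> // [e eF|X _ _ /eqP].
    by have := rankF [set e]; rewrite sub1set cards1; apply=> //; apply: loopless.
  by rewrite cards_eq0 => /eqP->.
have [b bB] : exists b, b \in B by apply/set0Pn; rewrite -card_gt0 cardB.
have cardB' : #|B :\ b| = D by move: cardB; rewrite (cardsD1 b) bB add1n => -[].
(* H is the hyperplane spanned by B :\ b, within F *)
have [H HP] := set_of_pred (fun e => e \in F /\ (e \in B :\ b \/ ~ ind (e |: B :\ b))).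
have HF : H \subset F by apply/subsetP => e /HP[].
have B'H : B :\ b \subset H.
  apply/subsetP => e eB'; apply/HP; split; last by left.
  by apply: (subsetP BF); move: eB'; rewrite inE => /andP[].
have rankH X : X \subset H -> ind X -> (#|X| <= D)%N.
  move=> XH indX; rewrite leqNgt; apply/negP => lt_DX.
  have [||e] := indU (B :\ b) X _ indX; first by apply: indS indB; apply: subsetDl.
    by rewrite cardB'.
  rewrite inE => /andP[eB' eX] ind_e.
  by have /HP[_ [eB''|//]] := subsetP XH e eX; rewrite eB'' in eB'.
have [||lvl [lvlD lvl_surj lvlP]] := IHD H (B :\ b) _ B'H _ cardB' rankH.
- by move=> e /(subsetP HF)/loopless.
- by apply: indS indB; apply: subsetDl.
have bH : b \notin H.
  by apply/negP => /HP[_ []]; rewrite ?setD1K // !inE eqxx.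
exists (fun e => if e \in H then lvl e else D); split.
- by move=> e eF; case: ifP => // /lvlD/ltnW.
- move=> l; rewrite ltnS leq_eqVlt => /orP[/eqP->|/lvl_surj[e eH <-]].
    by exists b; [exact: (subsetP BF) | rewrite (negbTE bH)].
  by exists e; [exact: (subsetP HF) | rewrite eH].
move=> X XF inj cardX.
have [t tX tH] : exists2 t, t \in X & t \notin H.
  apply/subsetPn/negP => XH; suff: (#|X| <= D)%N by rewrite cardX ltnn.
  apply: (@card_inj_lt X lvl) => [e e' eX e'X eq_lvl|e /(subsetP XH)/lvlD//].
  by apply: inj => //; rewrite !(subsetP XH).
have X'H : X :\ t \subset H.
  apply/subsetP => e; rewrite !inE => /andP[ne_et eX].
  apply: contraNT ne_et => eH; apply/eqP/inj => //.
  by rewrite (negbTE eH) (negbTE tH).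
have cardX' : #|X :\ t| = D by move: cardX; rewrite (cardsD1 t) tX add1n => -[].
have indX' : ind (X :\ t).
  apply: lvlP => // e e' eX' e'X' eq_lvl.
  move: (eX') (e'X'); rewrite !inE => /andP[_ eX] /andP[_ e'X].
  by apply: inj => //; rewrite !(subsetP X'H).
have tB' : t \notin B :\ b by apply: contra tH; apply: subsetP.
have ind_t : ind (t |: B :\ b).
  apply: NNPP => nind; case/negP: tH; apply/HP; split; last by right.
  exact: (subsetP XF).
have [|e] := indU _ _ indX' ind_t; first by rewrite cardsU1 tB' cardB' cardX'.
rewrite !inE negb_and negbK; have [-> _|ne_et /=] := eqVneq e t.
  by rewrite setD1K.
move=> /andP[eX /andP[ne_eb eB]] ind_e; exfalso.
have : (#|e |: X :\ t| <= D)%N.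
  apply: rankH => //; rewrite subUset sub1set X'H andbT.
  by apply: (subsetP B'H); rewrite !inE ne_eb.
by rewrite cardsU1 !inE ne_et /= eX cardX' ltnn.
Qed.

End Matroid.

(** * Regular sequences of monomials *)

Lemma is_max_bounded (P : nat -> Prop) N :
  P 0%N -> (forall r, P r -> (r <= N)%N) -> exists m, is_max P m.
Proof.
move=> P0; elim: N => [|N IHN] leN.
  by exists 0%N; split=> // r /leN.
have [PN|nPN] := classic (P N.+1); first by exists N.+1; split.
apply: IHN => r Pr; have := leN r Pr; rewrite leq_eqVlt => /orP[/eqP rN|//].
by rewrite rN in Pr.
Qed.

Section MonomialSequences.
Variables (n : nat) (K : fieldType).
Local Notation S := {mpoly K[n]}.
Implicit Types (I : S -> Prop) (u v w : 'X_{1..n}) (s : seq 'X_{1..n}).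

Definition coprime_monomials s : Prop :=
  (forall a, (a < size s)%N -> nth 0%MM s a <> 0%MM) /\
  forall a b, (a < size s)%N -> (b < size s)%N -> a <> b ->
    forall i, nth 0%MM s a i = 0%N \/ nth 0%MM s b i = 0%N.

Lemma ideal_adjoin_monomials s :
  ideal_adjoin (@zero_ideal n K) [seq 'X_[u] | u <- s] =
  monomial_gen (fun u => u \in s).
Proof.
apply: pred_ext => f; split; apply: ideal_gen_min; try exact: ideal_gen_ideal.
  move=> g [->|/mapP[u us ->]]; last exact: mpolyX_gen.
  exact: (idl0 (monomial_gen_ideal _)).
by move=> g [u us ->]; apply: mem_ideal_gen; right; apply: map_f.
Qed.

(** If [u_a] and [u_b], with [a < b], share a variable, then
    [lcm(u_a, u_b) / u_b] lies in the ideal of the first [b] monomials by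
    regularity, so it is divisible by one of them, necessarily not [u_a]; this
    one divides [u_a] and is coprime to it by induction. *)
Lemma regular_monomials_coprime s :
  regular_seq (@zero_ideal n K) [seq 'X_[u] | u <- s] -> coprime_monomials s.
Proof.
move=> [reg proper]; pose u a := nth 0%MM s a.
have u_neq0 a : (a < size s)%N -> u a <> 0%MM.
  move=> lt_a ua0; apply: proper; rewrite ideal_adjoin_monomials -mpolyX0 -ua0.
  exact/mpolyX_gen/mem_nth.
split=> //; suff H m : (m <= size s)%N -> forall a b, (a < m)%N -> (b < m)%N ->
    a <> b -> forall i, u a i = 0%N \/ u b i = 0%N by exact: (H (size s)).
elim: m => // m IHm lt_m.
have main a i : (a < m)%N -> u a i = 0%N \/ u m i = 0%N.
  move=> lt_am; apply: NNPP => /not_or_and[uai umi].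
  have := reg m; rewrite size_map => /(_ lt_m 'X_[u a - u m]).
  rewrite -map_take ideal_adjoin_monomials (nth_map 0%MM) // -mpolyXD -/(u m).
  move=> reg_m.
  have : exists2 w, w \in take m s & (w <= u a - u m)%MM.
    apply/(monomial_genX (K := K))/reg_m/monomial_genX; exists (u a).
      by rewrite -[u a](nth_take _ lt_am) mem_nth // size_take lt_m.
    by apply/mnm_lepP => j; rewrite mnmDE mnmBE; lia.
  case=> w /(nthP 0%MM)[c]; rewrite size_take lt_m => lt_cm.
  rewrite nth_take // -/(u c) => <- /mnm_lepP le_uc.
  have [eq_ca|ne_ca] := eqVneq c a.
    by have := le_uc i; rewrite eq_ca mnmBE; lia.
  apply: (u_neq0 c); first exact: ltn_trans lt_cm lt_m.
  apply/mnmP => j; rewrite mnm0E; have := le_uc j; rewrite mnmBE.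
  have /eqP {}ne_ca := ne_ca.
  have [//|-> le_c0] := IHm (ltnW lt_m) c a lt_cm lt_am ne_ca j.
  by apply/eqP; rewrite -leqn0.
move=> a b + + ne_ab i; rewrite ltnS leq_eqVlt => /orP[/eqP eq_am|lt_am];
  rewrite ltnS leq_eqVlt => /orP[/eqP eq_bm|lt_bm].
- by rewrite eq_am eq_bm in ne_ab.
- by rewrite eq_am or_comm; apply: main.
- by rewrite eq_bm; apply: main.
- exact: (IHm (ltnW lt_m)).
Qed.

Lemma size_coprime_monomials s : coprime_monomials s -> (size s <= n)%N.
Proof.
move=> [nz cop].
have /fin_all_exists[f fP] (a : 'I_(size s)) : exists i, nth 0%MM s a i <> 0%N.
  exact/mnm_neq0/nz.
have inj : injective f.
  move=> a b eq_f; apply: val_inj; apply: NNPP => ne_ab.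
  have [] := cop a b (ltn_ord a) (ltn_ord b) ne_ab (f a); first exact: fP.
  by rewrite eq_f; apply: fP.
by have := leq_card f inj; rewrite !card_ord.
Qed.

(** A sequence of coprime monomials has at most [n] terms, so that the maximum
    defining [nu I] is attained. *)
Lemma nu_coprime_monomials I k : (k <= nu I)%N ->
  exists s, [/\ size s = k, forall u, u \in s -> I 'X_[u] & coprime_monomials s].
Proof.
rewrite /nu; set P := fun r : nat => _; have [||m maxm] := @is_max_bounded P n.
- exists [::]; split=> //; split=> //= id1.
  have : zero_ideal (1 : S).
    apply: ideal_gen_min id1 => [|g [-> //|//]].
    by split=> // [f g -> ->|f g ->]; rewrite /zero_ideal ?addr0 ?mulr0.
  by move/eqP; rewrite oner_eq0.
- move=> r [s [<- _ /regular_monomials_coprime]]; exact: size_coprime_monomials.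
rewrite (nat_maxP maxm) => le_km; case: maxm => [[s [sz_s sI reg]] _].
have [nz cop] := regular_monomials_coprime reg.
have sz : size (take k s) = k by rewrite size_take_min sz_s; apply/minn_idPl.
exists (take k s); split=> // [u /mem_take/sI //|]; split; rewrite sz.
  by move=> a lt_ak; rewrite nth_take //; apply: nz; rewrite sz_s (leq_trans lt_ak).
move=> a b lt_a lt_b ne_ab i; rewrite !nth_take //.
by apply: cop => //; rewrite sz_s; [exact: leq_trans lt_a _ | exact: leq_trans lt_b _].
Qed.

End MonomialSequences.

(** * Squarefree powers of matroidal ideals *)

Section SetMonomials.
Variable n : nat.
Implicit Types (u : 'X_{1..n}) (A B X : {set 'I_n}) (i : 'I_n).

Lemma mesym1E A i : mesym1 A i = (i \in A).
Proof. exact: mnmE. Qed.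

Lemma squarefree_mesym1 A : squarefree_mon (mesym1 A).
Proof. by move=> i; rewrite mesym1E leq_b1. Qed.

Lemma squarefree_monE u : squarefree_mon u -> u = mesym1 (supp_mon u).
Proof.
by move=> sqf; apply/mnmP => i; rewrite mesym1E inE; have := sqf i; case: (u i) => [|[]].
Qed.

Lemma mesym1_imset D (t : nat -> 'I_n) : {in [pred l | (l < D)%N] &, injective t} ->
  (\sum_(l < D) U_(t l))%MM = mesym1 [set t l | l : 'I_D].
Proof.
move=> inj; apply/mnmP => i; rewrite mnm_sumE mesym1E.
have [/imsetP[l _ ->]|iX] := boolP (i \in _).
  rewrite (bigD1 l) //= mnm1E eqxx big1 // => l' ne_l; rewrite mnm1E.
  by case: eqP => // /inj/val_inj eq_l; rewrite eq_l ?inE ?eqxx in ne_l.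
rewrite big1 // => l _; rewrite mnm1E; case: eqP => // eq_i.
by rewrite -eq_i imset_f in iX.
Qed.

Lemma mesym1_color_classes k (g : 'I_n -> 'I_k) X :
  mesym1 X = (\sum_c mesym1 (color_class g X c))%MM.
Proof.
apply/mnmP => i; rewrite mnm_sumE mesym1E; under eq_bigr do rewrite mesym1E inE.
rewrite (bigD1 (g i)) //= eqxx andbT big1 ?addn0 // => c /negbTE.
by rewrite eq_sym => ->; rewrite andbF.
Qed.

End SetMonomials.

Section MatroidalIdeal.
Variables (n : nat) (K : fieldType) (I : {mpoly K[n]} -> Prop).
Local Notation S := {mpoly K[n]}.
Implicit Types (u v w : 'X_{1..n}) (A B X : {set 'I_n}) (i : 'I_n).

Definition basis B : Prop := mingens I (mesym1 B).

Definition independent A : Prop := exists2 B, basis B & A \subset B.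

Definition squarefree_product k w : Prop :=
  squarefree_mon w /\
  exists2 t : k.-tuple 'X_{1..n}, forall u, u \in t -> mingens I u
                                & w = (\sum_(u <- t) u)%MM.

Hypothesis I_matroidal : matroidal I.
Variable d : nat.
Hypothesis I_degree : forall u, mingens I u -> mdeg u = d.

Lemma basis_supp u : mingens I u -> basis (supp_mon u).
Proof.
by move=> Iu; rewrite /basis -squarefree_monE //; apply: (proj2 I_matroidal).
Qed.

Lemma card_basis B : basis B -> #|B| = d.
Proof. by move/I_degree; rewrite mdeg_mesym1. Qed.

Lemma basis_exchange A B i : basis A -> basis B -> i \in A :\: B ->
  exists2 j, j \in B :\: A & basis (j |: A :\ i).
Proof.
move=> bA bB; rewrite inE => /andP[iB iA].
case: I_matroidal => [[_ _ exch] _]; have [|j] := exch _ _ bA bB i.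
  by rewrite !mesym1E iA (negbTE iB).
rewrite !mesym1E => lt_j; have [jA jB] : j \notin A /\ j \in B.
  by move: lt_j; do 2!case: (j \in _).
move=> Ij; exists j; first by rewrite inE jA.
rewrite /basis; congr (mingens I _): Ij.
apply/mnmP => x; rewrite mnmDE mnmBE !mnm1E !mesym1E !inE (eq_sym j) (eq_sym i).
have [->|_] := eqVneq x j; first by rewrite (negbTE jA).
by have [->|_] := eqVneq x i; rewrite ?iA ?subn0.
Qed.

Lemma independent_matroid u : mingens I u -> matroid_independence independent.
Proof.
move=> Iu; apply: (@bases_matroid_independence _ basis d).
- by exists (supp_mon u); apply: basis_supp.
- exact: card_basis.
- by move=> A B bA bB i; apply: basis_exchange.
Qed.

Lemma card_independent A : independent A -> (#|A| <= d)%N.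
Proof. by move=> [B /card_basis<-]; apply: subset_leq_card. Qed.

Lemma independent_basis A : independent A -> #|A| = d -> basis A.
Proof.
move=> [B bB AB] cardA; suff -> : A = B by [].
by apply/eqP; rewrite eqEcard AB cardA (card_basis bB) leqnn.
Qed.

Lemma card_union_independent k X : union_independent k independent X -> (#|X| <= k * d)%N.
Proof.
move=> [g gP]; rewrite (card_color_class g).
apply: (@leq_trans (\sum_(c < k) d)); last by rewrite sum_nat_const card_ord.
by apply: leq_sum => c _; apply: card_independent (gP c).
Qed.

(** The [k] colour classes have at most [d] elements each and [k d] together,
    so each of them is a basis. *)
Lemma union_independent_product k X : union_independent k independent X ->
  #|X| = (k * d)%N -> squarefree_product k (mesym1 X).
Proof.
move=> [g gP] cardX; split; first exact: squarefree_mesym1.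
have bg c : basis (color_class g X c).
  apply: independent_basis (gP c) _.
  have := leqif_sum (fun c _ => leqif_eq (card_independent (gP c))) (I := 'I_k) (P := xpredT).
  rewrite -card_color_class cardX sum_nat_const card_ord => -[_].
  by rewrite eqxx => /esym/forallP/(_ c)/eqP.
exists [tuple mesym1 (color_class g X c) | c < k].
  by move=> u /tnthP[c ->]; rewrite tnth_mktuple; apply: bg.
by rewrite big_tuple (mesym1_color_classes g); apply: eq_bigr => c _; rewrite tnth_mktuple.
Qed.

Lemma mdeg_squarefree_product k w : squarefree_product k w -> mdeg w = (k * d)%N.
Proof.
move=> [_ [t tI ->]]; rewrite mdeg_sum big_seq (eq_bigr (fun=> d)) => [|u /tI/I_degree//].
by rewrite -big_seq big_const_seq count_predT size_tuple iter_addn_0 mulnC.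
Qed.

Lemma mingens_squarefree_power k :
  mingens (squarefree_power I k) = squarefree_product k.
Proof. exact: (mingens_equigenerated K (@mdeg_squarefree_product k)). Qed.

(** Generators of [I] dividing the members of a regular sequence of monomials
    have disjoint supports, which are the colour classes of a basis of the
    [k]-fold union. *)
Lemma union_independent_exists k : (0 < k <= nu I)%N ->
  (exists u, mingens I u) /\
  exists2 X, union_independent k independent X & #|X| = (k * d)%N.
Proof.
move=> /andP[k_gt0 le_k]; have [s [sz_s sI [_ cop]]] := nu_coprime_monomials le_k.
have mI : monomial_ideal I by case: I_matroidal => [[]].
have /fin_all_exists[v vP] : forall a : 'I_k,
    exists v, mingens I v /\ (v <= nth 0%MM s a)%MM.
  move=> a; have [|v vmin le_v] := @minimal_monomial_exists n K I (nth 0%MM s a).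
    by apply: sI; rewrite mem_nth ?sz_s.
  by exists v; rewrite mingensE.
split; first by exists (v (Ordinal k_gt0)); case: (vP (Ordinal k_gt0)).
have disj a b i : (0 < v a i)%N -> (0 < v b i)%N -> a = b.
  move=> va vb; apply: val_inj; apply: NNPP => ne_ab.
  have [_ /mnm_lepP/(_ i) le_a] := vP a; have [_ /mnm_lepP/(_ i) le_b] := vP b.
  rewrite sz_s in cop.
  have [a0|b0] := cop a b (ltn_ord a) (ltn_ord b) ne_ab i.
    by rewrite a0 leqNgt va in le_a.
  by rewrite b0 leqNgt vb in le_b.
pose g i := if [pick a | 0 < v a i]%N is Some a then a else Ordinal k_gt0.
pose X := [set i | [exists a, 0 < v a i]%N].
have class_v c : color_class g X c = supp_mon (v c).
  apply/setP => i; rewrite !inE /g.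
  apply/andP/idP => [[/existsP[a va]]|vc].
    by case: pickP => [b vb /eqP<- //|/(_ a)]; rewrite va.
  split; first by apply/existsP; exists c.
  case: pickP => [b vb|/(_ c)]; last by rewrite vc.
  exact/eqP/(disj _ _ i).
exists X.
  exists g => c; rewrite class_v; exists (supp_mon (v c)) => //.
  by apply: basis_supp; case: (vP c).
rewrite (card_color_class g) (eq_bigr (fun=> d)) ?sum_nat_const ?card_ord // => c _.
by rewrite class_v; apply/card_basis/basis_supp; case: (vP c).
Qed.

End MatroidalIdeal.

(** * The depth *)

Section Depth.
Variables (n : nat) (K : fieldType).
Local Notation S := {mpoly K[n]}.
Implicit Types (A : 'X_{1..n} -> Prop) (u : 'X_{1..n}).

Lemma monomial_gen_max_ideal A (f : S) : (forall u, A u -> (0 < mdeg u)%N) ->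
  monomial_gen A f -> max_ideal f.
Proof.
move=> degA; apply: ideal_gen_min; first exact: max_ideal_ideal.
move=> _ [u /degA deg_u ->].
have [|i ui] := @mnm_neq0 n u; first by move=> u0; rewrite u0 mdeg0 in deg_u.
rewrite (@mpolyX_divl n K U_(i) u); last by rewrite lep1mP; apply/eqP.
exact/(idlMl (max_ideal_ideal n K))/max_idealX.
Qed.

(** The degree bounds the depth from below, the transversals from above. *)
Lemma depth_squarefree_transversals A D (lvl : 'I_n -> nat) : (0 < D)%N ->
  (forall u, A u -> squarefree_mon u /\ mdeg u = D) ->
  (forall i, (lvl i < D)%N) -> (forall l, (l < D)%N -> exists i, lvl i = l) ->
  (forall u, transversal_monomial lvl D u -> A u) ->
  depth_quot (@monomial_gen n K A) = D.-1.
Proof.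
move=> D_gt0 HA lvlD lvl_surj lvlA; set J := monomial_gen A.
have idJ : is_ideal J by apply: monomial_gen_ideal.
have Jm f : J f -> max_ideal f.
  by apply: monomial_gen_max_ideal => u /HA[_ ->].
apply: nat_maxP; split=> [|_ [s [<- ms /(regular_seqP idJ Jm ms) reg]]].
  have [s [sz_s us _ ms]] := universally_regular_exists K D.-1 (leqnn n).
  exists s; split=> //; apply/(regular_seqP idJ Jm ms).
  have [u Au] : exists u, A u.
    have /fin_all_exists[t tP] : forall l : 'I_D, exists i, lvl i = l.
      by move=> l; apply: lvl_surj.
    exists (\sum_(l < D) U_(t l))%MM; apply: lvlA.
    have t0 := t (Ordinal D_gt0).
    exists (fun l => if insub l is Some l' then t l' else t0) => [l lt_lD|].
      by rewrite insubT tP.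
    by apply: eq_bigr => l _; rewrite valK.
  have [sqf_u deg_u] := HA u Au.
  apply: (universally_regularP us).
    rewrite sz_s; apply: leq_trans (leq_pred D) _; rewrite -deg_u.
    by apply: mdeg_squarefree => // i; rewrite leqNgt ltn_ord.
  move=> w /HA[sqf_w deg_w]; split=> // [i|]; first by rewrite leqNgt ltn_ord.
  by rewrite sz_s deg_w prednK.
rewrite -ltnS prednK //.
apply: (regular_seq_lt_parts idJ _ D_gt0 lvlD lvl_surj _ ms reg).
  move=> f /monomial_genP Jf w /Jf[u /HA[_ <-] le_uw]; exact: lem_mdeg.
by move=> u /lvlA; apply: mpolyX_gen.
Qed.

End Depth.

Theorem theorem1p6 (K : fieldType) (n : nat) (I : {mpoly K[n]} -> Prop)
    (I_matroidal : matroidal I) (I_supp : forall i : 'I_n, supp_ideal I i) :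
  forall k : nat, (1 <= k <= nu I)%N -> normalized_depth I k = 0.
Proof.
move=> k k_nu; have [[_ [d I_degree] _] _] := I_matroidal.
have [[u0 Iu0] [X0 indX0 cardX0]] := union_independent_exists I_matroidal I_degree k_nu.
have k_gt0 : (0 < k)%N by case/andP: k_nu.
have indepI := independent_matroid I_matroidal I_degree Iu0.
have indepU := union_matroid_independence k_gt0 indepI.
have product := union_independent_product I_degree (k := k).
have min_deg : min_degree I k = (k * d)%N.
  apply: nat_minP; rewrite (mingens_squarefree_power I_degree); split.
    by exists (mesym1 X0); [exact: product | rewrite mdeg_mesym1].
  by move=> _ [w /(mdeg_squarefree_product I_degree) <- <-].
have d_gt0 : (0 < d)%N.
  (* a nonconstant monomial provides a variable, and I_supp a generator of
     positive degree *)
  have [s [sz_s _ [nz _]]] := nu_coprime_monomials (proj2 (andP k_nu)).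
  have [|i _] := @mnm_neq0 n (nth 0%MM s 0); first by apply: nz; rewrite sz_s.
  have [u Iu] := I_supp i; rewrite inE -(I_degree u Iu) mdegE => ui.
  by rewrite (bigD1 i) //= addn_gt0 ui.
have kd_gt0 : (0 < k * d)%N by rewrite muln_gt0 k_gt0.
have loopless i : union_independent k (independent I) [set i].
  have [u Iu ui] := I_supp i; exists (fun=> Ordinal k_gt0) => c.
  exists (supp_mon u); first exact: (basis_supp I_matroidal).
  by apply/subsetP => j; rewrite !inE => /andP[/eqP-> _]; move: ui; rewrite inE.
have [|||lvl [lvlD lvl_surj lvlP]] :=
  independent_transversals (F := setT) indepU _ _ indX0 cardX0 _.
- by [].
- exact: subsetT.
- by move=> X _; apply: card_union_independent.
rewrite /normalized_depth min_deg.
have -> : depth_quot (squarefree_power I k) = (k * d).-1.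
  apply: (@depth_squarefree_transversals _ _ _ _ lvl) => //.
  - move=> u prod_u; split; first by case: prod_u.
    exact: (mdeg_squarefree_product I_degree).
  - by move=> i; apply: lvlD.
  - by move=> l /lvl_surj[i _ lvl_i]; exists i.
  move=> _ [t tP ->].
  have lvl_t (l : 'I_(k * d)) : lvl (t l) = l by apply: tP.
  have inj_t : injective (fun l : 'I_(k * d) => t l).
    by move=> l l' /(congr1 lvl); rewrite !lvl_t => /val_inj.
  have card_t : #|[set t l | l : 'I_(k * d)]| = (k * d)%N.
    by rewrite card_imset // card_ord.
  rewrite mesym1_imset; last first.
    by move=> l l' lD l'D eq_t; rewrite -(tP l lD) -(tP l' l'D) eq_t.
  apply: product => //; apply: lvlP => //.
  by move=> _ _ /imsetP[l _ ->] /imsetP[l' _ ->]; rewrite !lvl_t => /val_inj->.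
by move: (k * d)%N kd_gt0 => D D_gt0; lia.
Qed.
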